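(* Let $d>3$ be an integer. Any finite graph $G$ with less than $\binom{d+2}{2}$ edges can be realized in $\mathbb{R}^d$. If moreover $G$ contains neither $K_{d+2}-K_3$ nor $K_{d+1}$ as a subgraph, then $G$ can be realized in $\mathbb{S}^{d-1}$.
   Context: All graphs are finite, simple and undirected. $\mathbb{S}^{d-1}\subset\mathbb{R}^d$ denotes the sphere of radius $1/\sqrt{2}$ centred at the origin. A graph $G=(V,E)$ can be realized in a subset $X\subseteq\mathbb{R}^d$ if there is an injective map $\phi\colon V\to X$ such that $|\phi(x)-\phi(y)|=1$ (Euclidean distance) for every edge $xy\in E$; non-adjacent vertices may also be mapped to points at distance $1$. $K_n$ is the complete graph on $n$ vertices, and $K_{d+2}-K_3$ is the graph obtained from $K_{d+2}$ by deleting the three edges of a triangle (keeping all vertices). ''Contains'' means as a (not necessarily induced) subgraph. *)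

(* Defs.v *)
From mathcomp Require Import all_boot all_order all_algebra.
From mathcomp Require Import classical_sets reals.

Set Implicit Arguments.
Unset Strict Implicit.
Unset Printing Implicit Defensive.

Import Order.TTheory GRing.Theory Num.Theory.

Local Open Scope ring_scope.

Record sgraph := SGraph {
  vertex :> finType;
  adj : rel vertex;
  adj_sym : symmetric adj;
  adj_irrefl : irreflexive adj }.

Arguments adj {s} x y.

Definition edges (G : sgraph) : {set {set G}} :=
  [set [set x; y] | x in [set: G], y in [set: G] & adj x y]%SET.

(* Not necessarily induced subgraphs, up to isomorphism. *)
Definition contains (G H : sgraph) : Prop :=
  exists2 f : H -> G, injective f & forall x y, adj x y -> adj (f x) (f y).

Fact complete_sym n : symmetric (fun x y : 'I_n => x != y).
Proof. by move=> x y; rewrite eq_sym. Qed.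

Fact complete_irrefl n : irreflexive (fun x y : 'I_n => x != y).
Proof. by move=> x; rewrite eqxx. Qed.

Definition complete (n : nat) : sgraph :=
  SGraph (@complete_sym n) (@complete_irrefl n).

Definition complete_minus_adj (n m : nat) : rel 'I_n :=
  fun x y => (x != y) && ~~ ((x < m)%N && (y < m)%N).

Arguments complete_minus_adj : clear implicits.

Fact complete_minus_sym n m : symmetric (complete_minus_adj n m).
Proof.
by move=> x y; rewrite /complete_minus_adj eq_sym [(x < m)%N && _]andbC.
Qed.

Fact complete_minus_irrefl n m : irreflexive (complete_minus_adj n m).
Proof. by move=> x; rewrite /complete_minus_adj eqxx. Qed.

(* K_n - K_m (for m <= n): the deleted clique sits on the vertices 0 .. m-1;
   all n vertices are kept. *)
Definition complete_minus (n m : nat) : sgraph :=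
  SGraph (@complete_minus_sym n m) (@complete_minus_irrefl n m).

(* The library norm on ['rV[R]_d] is the sup norm, hence this definition. *)
Definition enorm (R : realType) (d : nat) (x : 'rV[R]_d) : R :=
  Num.sqrt (\sum_(i < d) x 0 i ^+ 2).

(* The sphere in R^d has radius 1 / sqrt 2, not 1. *)
Definition sphere (R : realType) (d : nat) : set 'rV[R]_d :=
  [set x | enorm x = 1 / Num.sqrt 2]%classic.

Arguments sphere : clear implicits.

Definition realizable (R : realType) (d : nat) (G : sgraph)
    (X : set 'rV[R]_d) : Prop :=
  exists phi : G -> 'rV[R]_d,
    [/\ injective phi,
        forall x, X (phi x)
      & forall x y, adj x y -> enorm (phi x - phi y) = 1].

(* Main.v *)
Require Import Defs.
From mathcomp Require Import classical_sets reals.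
From mathcomp Require Import all_boot all_order all_algebra.
From mathcomp Require Import zify ring lra.

Set Implicit Arguments.
Unset Strict Implicit.
Unset Printing Implicit Defensive.

Import Order.TTheory GRing.Theory Num.Theory.

(** On the sphere of radius 1/sqrt 2 two points are at distance 1 exactly when
    they are orthogonal.  After scaling, a graph is thus realized in the sphere
    by distinct unit vectors such that adjacent vertices get orthogonal ones:
    this is [orthorep S d] for the subgraph induced on a set [S] of vertices.

    Such representations are built from two moves.  A vertex of degree at
    most d - 2 can always be added, as the vectors orthogonal to those of its
    neighbours contain a circle ([orthorep_add_low_degree]); so the minimum
    degree may be assumed to be at least d - 1.  Representations of A and B in
    orthogonal spaces give one of A :|: B whatever the edges between A and B
    ([orthorep_join]).  In particular two nonadjacent vertices cost only one
    dimension, being placed at opposite points ([orthorep_add_nonadj]).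

    If |S| = d + 2, two disjoint pairs of nonadjacent vertices suffice.  If they
    do not exist, the missing edges form a star or lie in a triangle, and
    K_(d+1) or K_(d+2) - K_3 is contained ([orthorep_card_le_add2]).  Let
    |S| >= d + 3 and d >= 5.  Removing a nonadjacent pair destroys at least
    2(d - 1) edges, more than the d + 1 by which the bound decreases from d to
    d - 1, and so few edges remain that neither forbidden graph of dimension
    d - 1 can survive; this is an induction on d ([orthorep_few_edges]).  Only
    for d = 5 and |S| = 8 does the pair have to be chosen
    ([eight_vertices_pair]).

    The induction starts at d = 4, with at most 14 edges, minimum degree 3 and
    at least 7 vertices ([orthorep4_degsum_lt30]).  If two nonadjacent vertices
    have degrees adding up to 8 or more, at most 6 edges remain without them,
    few enough for R^3 ([orthorep3_degsum_le12]).  Otherwise a vertex of degree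
    at least 5 is adjacent to all others; there are then 7 or 8 vertices, and
    the others fit into R^3 ([orthorep3_six], [orthorep3_seven]).  In
    the last case all degrees are at most 4 and the vertices of degree 4 form a
    clique: a suitable maximum cut splits S into two parts whose induced graphs
    have components that are paths with at most four vertices, and each part
    lives in a plane ([orthorep4_clique_excess], [orthorep2_sparse]).

    For the first claim it remains to treat graphs that contain one of the two
    forbidden graphs.  The other edges are then so few that one or two vertices
    have all their neighbours in a d-clique of the remaining graph.  The latter
    lies on the sphere; the d points of that clique and the two points at
    distance 1 from all of them ([realizable_apex]) do the rest. *)

(** * Counting edges in sets of vertices *)

Section Counting.
Variable G : sgraph.
Implicit Types (S A B C K Y : {set G}) (x y u v w p q r : G).

Definition deg S x := #|[set y in S | adj x y]|.

(** Counting every edge of the induced subgraph twice keeps all bounds free of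
    divisions. *)
Definition degsum S := \sum_(x in S) deg S x.

Lemma degE S x : deg S x = \sum_(y in S) adj x y.
Proof.
rewrite /deg -sum1_card big_mkcond [RHS]big_mkcond /=.
by apply: eq_bigr => y _; rewrite inE; case: (y \in S); case: (adj x y).
Qed.

Lemma deg_sumE S x : deg S x = \sum_y ((y \in S) && adj x y).
Proof. by rewrite degE big_mkcond; apply: eq_bigr => y _; case: (y \in S). Qed.

Lemma deg_le_card A x : deg A x <= #|A|.
Proof. by rewrite /deg; apply/subset_leq_card/subsetP => y; rewrite inE => /andP[]. Qed.

Lemma deg_sub A S x : A \subset S -> deg A x <= deg S x.
Proof.
move=> sAS; rewrite /deg; apply/subset_leq_card/subsetP => y; rewrite !inE => /andP[yA ->].
by rewrite (subsetP sAS).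
Qed.

Lemma deg_rem S x y : deg S x = deg (S :\ y) x + ((y \in S) && adj x y).
Proof.
rewrite !degE; case: (boolP (y \in S)) => yS /=; first by rewrite (big_setD1 y) //= addnC.
rewrite addn0; apply: eq_bigl => z; rewrite !inE; case: eqP => // ->.
by rewrite (negbTE yS).
Qed.

Lemma deg_rem_nonadj S x y : ~~ adj x y -> deg (S :\ y) x = deg S x.
Proof. by move=> /negbTE nxy; rewrite (deg_rem S x y) nxy andbF addn0. Qed.

Lemma deg_rem_self S x : deg (S :\ x) x = deg S x.
Proof. by rewrite deg_rem_nonadj // adj_irrefl. Qed.

Lemma leq_deg_rem S x y : deg S x <= (deg (S :\ y) x).+1.
Proof. by rewrite (deg_rem S x y); case: (_ && _); rewrite ?addn0 ?addn1. Qed.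

Lemma leq_deg_rem2 S u v x : deg S x <= (deg (S :\ u :\ v) x).+2.
Proof. by apply: leq_trans (leq_deg_rem S x u) _; rewrite ltnS leq_deg_rem. Qed.

Lemma deg_lt_card S x : x \in S -> deg S x < #|S|.
Proof.
move=> xS; rewrite /deg; apply/proper_card/properP; split.
  by apply/subsetP => y; rewrite inE => /andP[].
by exists x => //; rewrite inE adj_irrefl andbF.
Qed.

Lemma deg_le1_nbr S p q r : deg S p <= 1 -> q \in S -> r \in S ->
  adj p q -> adj p r -> r = q.
Proof.
move=> /card_le1_eqP h qS rS pq pr; apply: h; by rewrite inE ?qS ?rS.
Qed.

Lemma deg_le2_nbr S p q q' r : deg S p <= 2 -> q \in S -> q' \in S -> q != q' ->
  adj p q -> adj p q' -> r \in S -> adj p r -> r \in [set q; q'].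
Proof.
move=> degp qS q'S qq' pq pq' rS pr.
have /eqP-> : [set q; q'] == [set y in S | adj p y]; last by rewrite inE rS.
rewrite eqEcard cards2 qq' degp andbT.
by apply/subsetP => y; rewrite !inE => /orP[]/eqP->; rewrite ?qS ?q'S.
Qed.

Lemma card_rem2 S u v : u \in S -> v \in S -> u != v ->
  #|S| = #|S :\ u :\ v|.+2.
Proof.
by move=> uS vS uv; rewrite (cardsD1 u S) uS (cardsD1 v (S :\ u)) in_setD1 eq_sym uv vS.
Qed.

Lemma degsum_rem S x : x \in S -> degsum S = degsum (S :\ x) + 2 * deg S x.
Proof.
move=> xS; rewrite /degsum (big_setD1 x) //=.
under eq_bigr => y _ do rewrite (deg_rem S y x) xS /=.
rewrite big_split /= mul2n -addnn [RHS]addnC -addnA; congr (_ + _).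
rewrite [RHS]addnC; congr (_ + _).
rewrite -(deg_rem_self S) degE; apply: eq_bigr => y _.
by rewrite adj_sym.
Qed.

Lemma degsum_sub A S : A \subset S -> degsum A <= degsum S.
Proof.
move=> sAS; rewrite /degsum [leqRHS](big_setID A) /= (setIidPr sAS).
apply: leq_trans (leq_addr _ _); apply: leq_sum => x _; exact: deg_sub.
Qed.

Lemma degsum_even S : ~~ odd (degsum S).
Proof.
have [n] := ubnP #|S|; elim: n S => // n IHn S.
have [-> _|[x xS]] := set_0Vmem S; first by rewrite /degsum big_set0.
rewrite (cardsD1 x) xS /= add1n ltnS => /IHn.
by move=> evenD; rewrite (degsum_rem xS) oddD mul2n odd_double addbF.
Qed.

Lemma degsum_rem2 S u v : u \in S -> v \in S -> u != v -> ~~ adj u v ->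
  degsum S = degsum (S :\ u :\ v) + 2 * (deg S u + deg S v).
Proof.
move=> uS vS nuv auv; rewrite (degsum_rem uS) (@degsum_rem _ v) ?inE 1?eq_sym ?nuv //.
rewrite deg_rem_nonadj; last by rewrite adj_sym.
by rewrite mulnDr -addnA [X in _ + X]addnC.
Qed.

Lemma degsum_out A S w : A \subset S -> w \in S -> w \notin A ->
  degsum A + 2 * deg S w <= degsum S.
Proof.
move=> sAS wS wA; rewrite (degsum_rem wS) leq_add2r.
by apply: degsum_sub; rewrite subsetD1 sAS.
Qed.

(** Edges leaving [Y] are counted at both of their ends, whence the factor 2. *)
Lemma degsum_outward S Y : Y \subset S ->
  degsum Y + 2 * \sum_(y in Y) deg (S :\: Y) y <= degsum S.
Proof.
move=> sYS; have degD x : deg S x = deg Y x + deg (S :\: Y) x.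
  rewrite !deg_sumE -big_split /=; apply: eq_bigr => y _; rewrite in_setD.
  by case: (boolP (y \in Y)) => [/(subsetP sYS)->|_] /=; rewrite ?addn0.
rewrite /degsum [leqRHS](big_setID Y) /= (setIidPr sYS).
rewrite (eq_bigr _ (fun x _ => degD x)) big_split /= -addnA leq_add2l mul2n -addnn leq_add2l.
have -> : \sum_(y in Y) deg (S :\: Y) y = \sum_(x in S :\: Y) deg Y x.
  under eq_bigr do rewrite degE; under [RHS]eq_bigr do rewrite degE.
  by rewrite exchange_big /=; apply: eq_bigr => x _; apply: eq_bigr => y _; rewrite adj_sym.
by apply: leq_sum => x _; exact: deg_sub.
Qed.

Lemma degsum_ge S k : {in S, forall x, k <= deg S x} -> k * #|S| <= degsum S.
Proof.
by move=> kS; rewrite mulnC -sum_nat_const; apply: leq_sum => x; exact: kS.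
Qed.

Lemma degsum_ge_one S x k : x \in S -> {in S, forall y, k <= deg S y} ->
  deg S x + k * #|S|.-1 <= degsum S.
Proof.
move=> xS kS; rewrite /degsum (big_setD1 x) //= leq_add2l (cardsD1 x) xS /= mulnC.
by rewrite -sum_nat_const; apply: leq_sum => y /setD1P[_]; exact: kS.
Qed.

(** Both sides count the incidences between vertices and edges. *)
Lemma degsum_setT : degsum [set: G] = 2 * #|edges G|.
Proof.
have card2 : {in edges G, forall E : {set G}, #|E| = 2}.
  move=> E /imset2P[x y _]; rewrite !inE /= => axy ->.
  by rewrite cards2; case: eqP axy => // ->; rewrite adj_irrefl.
rewrite mulnC -sum_nat_const -(eq_bigr _ card2).
under [RHS]eq_bigr => E _ do rewrite -sum1_card big_mkcond /=.
rewrite exchange_big /= /degsum big_mkcond /=.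
apply: eq_bigr => x _; rewrite inE -big_mkcondr sum1_card /deg.
(* Neighbours of [x] correspond to the edges at [x]. *)
have inj : {in [set y in [set: G] | adj x y] &, injective (fun y => [set x; y])}.
  move=> y z; rewrite !inE /= => axy axz /setP /(_ y); rewrite !inE eqxx orbT.
  case: eqP axy => [->|_ _] /=; first by rewrite adj_irrefl.
  by move/esym/eqP.
rewrite -(card_in_imset inj); apply: eq_card => E.
rewrite [in RHS]unfold_in /=; apply/imsetP/andP => [[y]|[/imset2P[y z _]]].
  rewrite !inE /= => axy ->; rewrite !inE eqxx; split => //.
  by apply/imset2P; exists x y; rewrite ?inE.
rewrite !inE /= => ayz ->; rewrite !inE => /orP[]/eqP->.
  by exists z; rewrite ?inE.
by exists y; rewrite ?inE 1?adj_sym // setUC.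
Qed.

(** * Cliques and joins *)

(** The cliques are the sets that dominate themselves. *)
Definition dominates C Y :=
  (C \subset Y) && [forall x in C, forall y in Y, (x != y) ==> adj x y].

Lemma dominatesP C Y :
  reflect (C \subset Y /\ {in C & Y, forall x y, x != y -> adj x y})
          (dominates C Y).
Proof.
apply: (iffP andP) => -[sCY h]; split=> //.
  by move=> x y xC yY; apply/implyP; move/forall_inP/(_ x xC)/forall_inP: h; apply.
by apply/forall_inP => x xC; apply/forall_inP => y yY; apply/implyP; exact: h.
Qed.

Lemma nonadj_or_clique S :
  (exists u v, [/\ u \in S, v \in S, u != v & ~~ adj u v]) \/ dominates S S.
Proof.
have [|/forall_inPn[u uS /forall_inPn[v vS]]] :=
    boolP [forall x in S, forall y in S, (x != y) ==> adj x y].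
  by right; rewrite /dominates subxx.
by rewrite negb_imply => /andP[nuv auv]; left; exists u, v.
Qed.

Lemma deg_dominates C Y x : dominates C Y -> x \in C -> deg Y x = #|Y|.-1.
Proof.
move=> /dominatesP[sCY adjC] xC.
rewrite (cardsD1 x Y) (subsetP sCY) //=; apply: eq_card => y; rewrite !inE.
have [->|nyx] := eqVneq; first by rewrite adj_irrefl andbF.
by case: (boolP (y \in Y)) => //= yY; apply: adjC; rewrite // eq_sym.
Qed.

Lemma deg_dominated C Y y : dominates C Y -> y \in Y -> y \notin C -> #|C| <= deg Y y.
Proof.
move=> /dominatesP[sCY adjC] yY yC; rewrite /deg; apply/subset_leq_card/subsetP => x xC.
rewrite inE (subsetP sCY) //= adj_sym adjC //.
by apply: contraNneq yC => <-.
Qed.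

Lemma degsum_dominates C Y : dominates C Y ->
  #|C| * (#|Y|.-1 + (#|Y| - #|C|)) <= degsum Y.
Proof.
move=> domC; have /dominatesP[sCY _] := domC.
rewrite /degsum [leqRHS](big_setID C) /= (setIidPr sCY) mulnDr; apply: leq_add.
  by rewrite -sum_nat_const; apply: leq_sum => x xC; rewrite (deg_dominates domC).
rewrite mulnC -(setIidPr sCY) -cardsD -sum_nat_const (setIidPr sCY).
by apply: leq_sum => y; rewrite inE => /andP[yC yY]; exact: deg_dominated.
Qed.

Lemma nonneighbour_exists S u : u \in S -> deg S u < #|S|.-1 ->
  exists v, [/\ v \in S, u != v & ~~ adj u v].
Proof.
move=> uS low; have [/exists_inP[v vS /andP[uv nuv]]|/exists_inPn all_adj] :=
  boolP [exists v in S, (u != v) && ~~ adj u v]; first by exists v.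
have : dominates [set u] S.
  apply/dominatesP; split; first by rewrite sub1set.
  move=> x v /set1P -> vS uv; apply: contraT => nuv.
  by have := all_adj v vS; rewrite uv nuv.
by move/deg_dominates => /(_ u (set11 u)) dE; rewrite dE ltnn in low.
Qed.

(** K_(c+m) - K_m as a subgraph: a c-clique joined to m further vertices.
    For m = 0 it is K_c, so one predicate covers both forbidden graphs. *)
Definition has_join S c m :=
  [exists C : {set G}, exists Y : {set G},
    [&& dominates C Y, Y \subset S, #|C| == c & #|Y| == c + m]].

Lemma has_joinP S c m :
  reflect (exists C Y, [/\ dominates C Y, Y \subset S, #|C| = c & #|Y| = c + m])
          (has_join S c m).
Proof.
apply: (iffP existsP) => [[C /existsP[Y /and4P[? ? /eqP? /eqP?]]]|[C [Y [? ? /eqP? /eqP?]]]].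
  by exists C, Y.
by exists C; apply/existsP; exists Y; apply/and4P.
Qed.

Lemma has_join_sub A S c m : A \subset S -> has_join A c m -> has_join S c m.
Proof.
move=> sAS /has_joinP[C [Y [? sYA ? ?]]].
by apply/has_joinP; exists C, Y; split=> //; apply: subset_trans sAS.
Qed.

Lemma has_join_degsum S c m : has_join S c m -> c * ((c + m).-1 + m) <= degsum S.
Proof.
move=> /has_joinP[C [Y [domC sYS cC cY]]]; apply: leq_trans (degsum_sub sYS).
by have := degsum_dominates domC; rewrite cY cC addKn.
Qed.

Lemma has_join_remove S c m : has_join S c m -> c + m < #|S| ->
  exists2 w, w \in S & has_join (S :\ w) c m.
Proof.
move=> /has_joinP[C [Y [domC sYS cC cY]]] ltS.
have /subsetPn[w wS wY] : ~~ (S \subset Y).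
  by apply/negP => /subset_leq_card; rewrite cY leqNgt ltS.
by exists w => //; apply/has_joinP; exists C, Y; rewrite subsetD1 sYS wY.
Qed.

(** When S has a vertex outside the join, the edges at that vertex come on top
    of those of the join. *)
Lemma has_join_degsum_out S c m k : has_join S c m -> c + m < #|S| ->
    {in S, forall x, k <= deg S x} ->
  c * ((c + m).-1 + m) + 2 * k <= degsum S.
Proof.
move=> J ltS kS; have [w wS /has_join_degsum J'] := has_join_remove J ltS.
by move: (degsum_rem wS) (kS w wS) J'; clear; lia.
Qed.

Lemma clique_has_join S n : dominates S S -> n <= #|S| -> has_join S n 0.
Proof.
move=> /dominatesP[_ adjS] nS.
have [A [sAS cA]] : exists A, A \subset S /\ #|A| = n.
  exists [set x in take n (enum S)]; split.
    by apply/subsetP => x; rewrite inE => /mem_take; rewrite mem_enum.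
  rewrite cardsE (card_uniqP _) ?take_uniq ?enum_uniq // size_take -cardE.
  by case: ltnP => // Sn; apply/eqP; rewrite eqn_leq Sn.
apply/has_joinP; exists A, A; rewrite addn0; split=> //.
by apply/dominatesP; split=> // x y xA yA; apply: adjS; exact: (subsetP sAS).
Qed.

Lemma has_clique S c : has_join S c 0 ->
  exists K, [/\ dominates K K, K \subset S & #|K| = c].
Proof.
move=> /has_joinP[C [Y [domC sYS cC]]]; rewrite addn0 => cY.
have [sCY _] := dominatesP _ _ domC.
have CY : C = Y by apply/eqP; rewrite eqEcard sCY cC cY /=.
by exists Y; rewrite -{1}CY.
Qed.

Lemma clique_add K p : dominates K K -> {in K, forall y, adj p y} ->
  dominates (p |: K) (p |: K).
Proof.
move=> /dominatesP[_ adjK] adjp; apply/dominatesP; split=> // x y; rewrite !in_setU1.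
case/predU1P=> [->|xK] /predU1P[->|yK]; rewrite ?eqxx //.
- by rewrite adjp.
- by rewrite adj_sym adjp.
- exact: adjK.
Qed.

Lemma nonadj_exists S n : ~~ has_join S n 0 -> n <= #|S| ->
  exists u v, [/\ u \in S, v \in S, u != v & ~~ adj u v].
Proof.
move=> noK nS; case: (nonadj_or_clique S) => // /clique_has_join /(_ nS).
by rewrite (negbTE noK).
Qed.

(** Every nonadjacent pair will do when there are at most 19 edges.  With 20
    edges one needs a pair whose degrees add up to 9 or more, which a vertex of
    degree 5 or 6 provides.  Were all degrees 4 or 7, their sum would be
    congruent to 32 modulo 3, and 40 is not. *)
Lemma eight_vertices_pair S : #|S| = 8 -> degsum S < 42 ->
    {in S, forall x, 4 <= deg S x} -> ~~ has_join S 6 0 ->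
  exists u v, [/\ u \in S, v \in S, u != v, ~~ adj u v &
    degsum S < 24 + 2 * (deg S u + deg S v)].
Proof.
move=> S8 D42 ge4 noK; have D40 : degsum S <= 40.
  rewrite leqNgt; apply/negP => D40; have := degsum_even S.
  by have -> : degsum S = 41 by move: D40 D42; clear; lia.
have [D39|D39] := ltnP (degsum S) 39.
  have [|u [v [uS vS uv nuv]]] := nonadj_exists noK; first by rewrite S8.
  by exists u, v; split=> //; move: (ge4 u uS) (ge4 v vS) D39; clear; lia.
have [/exists_inP[u uS /andP[d4 d7]]|/exists_inPn no] :=
    boolP [exists u in S, (4 < deg S u) && (deg S u < 7)].
  have [|v [vS uv nuv]] := nonneighbour_exists uS; first by rewrite S8.
  by exists u, v; split=> //; move: (ge4 v vS) d4 D40; clear; lia.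
have : degsum S = \sum_(x in S) (4 + 3 * (deg S x != 4)).
  apply: eq_bigr => x xS; move: (ge4 x xS) (no x xS) (deg_lt_card xS).
  by rewrite S8; clear; case: eqP => /=; lia.
rewrite big_split -big_distrr sum_nat_const S8 /=; move: (\sum_(_ in _) _) => m.
by move: D39 D40; have := degsum_even S; clear; lia.
Qed.

Lemma contains_complete n : has_join [set: G] n 0 -> contains G (complete n).
Proof.
move=> /has_clique[K [/dominatesP[_ adjK] _ cK]].
exists (fun i : 'I_n => enum_val (cast_ord (esym cK) i)).
  by move=> i j /enum_val_inj/cast_ord_inj.
move=> i j ij; apply: adjK; rewrite ?enum_valP //.
by apply: contraNneq ij => /enum_val_inj/cast_ord_inj->.
Qed.

(** The m deleted-clique vertices come first in [complete_minus], hence the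
    order of the two lists in the enumeration. *)
Lemma contains_complete_minus c m : has_join [set: G] c m ->
  contains G (complete_minus (c + m) m).
Proof.
move=> /has_joinP[C [Y [/dominatesP[sCY adjC] _ cC cY]]].
pose s := enum (Y :\: C) ++ enum C.
have sI : size (enum (Y :\: C)) = m by rewrite -cardE cardsD (setIidPr sCY) cY cC addKn.
have ss : size s = c + m by rewrite size_cat sI -cardE cC addnC.
have us : uniq s.
  rewrite cat_uniq !enum_uniq andbT /=; apply/hasPn => x.
  by rewrite !mem_enum inE negb_and negbK => ->.
have sY x : x \in s -> x \in Y.
  by rewrite mem_cat !mem_enum inE => /orP[/andP[]|/(subsetP sCY)].
pose t := in_tuple s.
exists (fun i => tnth t (cast_ord (esym ss) i)).
  by move=> i j /(tuple_uniqP t us)/cast_ord_inj.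
have inC (i : 'I_(c + m)) : m <= i -> tnth t (cast_ord (esym ss) i) \in C.
  move=> mi; set x := tnth _ _; rewrite /x (tnth_nth x) /= nth_cat sI ltnNge mi /=.
  rewrite -mem_enum mem_nth // -cardE cC; move: (ltn_ord i) mi; clear; lia.
have inY (i : 'I_(c + m)) : tnth t (cast_ord (esym ss) i) \in Y.
  by apply: sY; exact: mem_tnth.
move=> i j /andP[ij]; rewrite negb_and -!leqNgt.
have nij : tnth t (cast_ord (esym ss) i) != tnth t (cast_ord (esym ss) j).
  by apply: contraNneq ij => /(tuple_uniqP t us)/cast_ord_inj->.
case/orP => [/inC iC|/inC jC]; first exact: adjC.
by rewrite adj_sym adjC // eq_sym.
Qed.

End Counting.

(** * Maximum cuts *)

(** A cut of maximum weight: moving a single vertex to the other side does not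
    lower the weight inside the two parts. *)
Lemma exists_stable_cut (T : finType) (w : T -> T -> nat) :
    (forall x y, w x y = w y x) -> (forall x, w x x = 0) ->
  exists A : {set T}, forall x,
    \sum_(y | (y \in A) == (x \in A)) w x y
      <= \sum_(y | (y \in A) != (x \in A)) w x y.
Proof.
move=> wC w0; pose inner (A : {set T}) x := \sum_(y | (y \in A) == (x \in A)) w x y.
pose cost A := \sum_x inner A x.
have [A _ minA] := arg_minnP (P := predT) (i0 := set0) cost isT.
exists A => x; pose A' := [set y | (y \in A) (+) (y == x)].
have A'x y : y != x -> (y \in A') = (y \in A) by rewrite inE => /negbTE->; rewrite addbF.
have xA' : (x \in A') = ~~ (x \in A) by rewrite inE eqxx addbT.
(* The part of the cost that changes when [x] changes sides, and the rest. *)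
have split_cost B : cost B = 2 * inner B x +
    \sum_(y | y != x) \sum_(z | ((z \in B) == (y \in B)) && (z != x)) w y z.
  rewrite /cost (bigD1 x) //= mul2n -addnn -addnA; congr (_ + _).
  have -> : inner B x = \sum_(y | y != x) (if (x \in B) == (y \in B) then w y x else 0).
    rewrite /inner (bigD1 x) //= w0 add0n -big_mkcondr.
    by apply: eq_big => [y|y _]; [rewrite andbC [(y \in B) == _]eq_sym | exact: wC].
  rewrite -big_split /=; apply: eq_bigr => y yx.
  case: ifP => xy; first by rewrite /inner (bigD1 x).
  rewrite add0n; apply: eq_bigl => z; have [->|_] := eqVneq z x; last by rewrite andbT.
  by rewrite xy.
have := minA A' isT; rewrite !split_cost.
rewrite (_ : \sum_(y | y != x) \sum_(z | ((z \in A') == (y \in A')) && (z != x)) w y z =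
  \sum_(y | y != x) \sum_(z | ((z \in A) == (y \in A)) && (z != x)) w y z); last first.
  apply: eq_bigr => y yx; apply: eq_bigl => z.
  by have [->|zx] := eqVneq z x; rewrite ?andbF // !A'x.
rewrite leq_add2r leq_mul2l /= => /leq_trans; apply.
rewrite /inner big_mkcond [leqRHS]big_mkcond /=; apply: leq_sum => y _.
have [->|yx] := eqVneq y x; first by rewrite w0; case: ifP.
by rewrite A'x // xA'; case: (y \in A); case: (x \in A).
Qed.

(** * Orthogonal vectors *)

Section Dot.
Local Open Scope ring_scope.
Variable R : realType.

Definition dot d (u v : 'rV[R]_d) : R := (u *m v^T) 0 0.

Lemma dotE d (u v : 'rV[R]_d) : dot u v = \sum_i u 0 i * v 0 i.
Proof. by rewrite /dot mxE; apply: eq_bigr => i _; rewrite mxE. Qed.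

Lemma dotC d (u v : 'rV[R]_d) : dot u v = dot v u.
Proof. by rewrite !dotE; apply: eq_bigr => i _; rewrite mulrC. Qed.

Lemma dotDl d (u v w : 'rV[R]_d) : dot (u + v) w = dot u w + dot v w.
Proof. by rewrite /dot mulmxDl mxE. Qed.

Lemma dotZl d a (u w : 'rV[R]_d) : dot (a *: u) w = a * dot u w.
Proof. by rewrite /dot -scalemxAl mxE. Qed.

Lemma dotNl d (u w : 'rV[R]_d) : dot (- u) w = - dot u w.
Proof. by rewrite /dot mulNmx mxE. Qed.

Lemma dotDr d (u v w : 'rV[R]_d) : dot w (u + v) = dot w u + dot w v.
Proof. by rewrite dotC dotDl !(dotC w). Qed.

Lemma dotZr d a (u w : 'rV[R]_d) : dot w (a *: u) = a * dot w u.
Proof. by rewrite dotC dotZl dotC. Qed.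

Lemma dotNr d (u w : 'rV[R]_d) : dot w (- u) = - dot w u.
Proof. by rewrite dotC dotNl dotC. Qed.

Lemma dot0l d (u : 'rV[R]_d) : dot 0 u = 0.
Proof. by rewrite /dot mul0mx mxE. Qed.

Lemma dot_suml d (I : Type) (r : seq I) (P : pred I) (F : I -> 'rV[R]_d) w :
  dot (\sum_(i <- r | P i) F i) w = \sum_(i <- r | P i) dot (F i) w.
Proof. by rewrite /dot mulmx_suml summxE. Qed.

Lemma dot_row d1 d2 (u1 v1 : 'rV[R]_d1) (u2 v2 : 'rV[R]_d2) :
  dot (row_mx u1 u2) (row_mx v1 v2) = dot u1 v1 + dot u2 v2.
Proof. by rewrite /dot tr_row_mx mul_row_col mxE. Qed.

Lemma dot_sub d (u v : 'rV[R]_d) :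
  dot (u - v)%R (u - v)%R = (dot u u + dot v v - 2 * dot u v)%R.
Proof. rewrite !(dotDl, dotDr, dotNl, dotNr) (dotC v u); ring. Qed.

Lemma dot_gt0 d (u : 'rV[R]_d) : u != 0 -> 0 < dot u u.
Proof.
move=> u0; have dot_ge0 : 0 <= dot u u.
  by rewrite dotE sumr_ge0 // => i _; rewrite -expr2 sqr_ge0.
rewrite lt_def dot_ge0 andbT; apply: contra_neq u0 => /eqP.
rewrite dotE psumr_eq0 => [/allP h|i _]; last by rewrite -expr2 sqr_ge0.
apply/rowP => i; rewrite mxE; apply/eqP.
by have := h i (mem_index_enum i); rewrite mulf_eq0 orbb.
Qed.

Lemma enormE d (u : 'rV[R]_d) : enorm u = Num.sqrt (dot u u).
Proof. by rewrite /enorm dotE; under eq_bigr do rewrite expr2. Qed.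

Lemma enorm_scale d (u : 'rV[R]_d) :
  enorm ((Num.sqrt 2)^-1 *: u)%R = Num.sqrt (dot u u / 2)%R.
Proof.
rewrite enormE dotZl dotZr mulrA -invfM -expr2 sqr_sqrtr ?ler0n //.
by rewrite mulrC.
Qed.

Lemma scale_injective d : injective (fun u : 'rV[R]_d => (Num.sqrt 2)^-1 *: u)%R.
Proof. by apply: scalerI; rewrite invr_eq0 sqrtr_eq0 -ltNge ltr0n. Qed.

(** Fewer than d linear equations in R^d have a nonzero solution. *)
Lemma exists_unit_orth d (s : seq 'rV[R]_d) : (size s < d)%N ->
  exists2 z : 'rV[R]_d, dot z z = 1 & {in s, forall v, dot z v = 0}.
Proof.
move=> szd; pose B := \matrix_(i < size s) s`_i.
have : kermx B^T != 0.
  rewrite -mxrank_eq0 mxrank_ker -lt0n subn_gt0.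
  exact: leq_ltn_trans (rank_leq_col _) szd.
rewrite -nz_row_eq0; set z := nz_row _ => z0.
have zB : z *m B^T = 0 by apply/sub_kermxP/nz_row_sub.
exists ((Num.sqrt (dot z z))^-1 *: z) => [|v vs].
  have z2 := dot_gt0 z0.
  rewrite dotZl dotZr mulrA -invfM -expr2 sqr_sqrtr ?ltW //.
  by rewrite mulVf ?gt_eqF.
rewrite dotZl; suff -> : dot z v = 0 by rewrite mulr0.
have iv : (index v s < size s)%N by rewrite index_mem.
have /rowP/(_ (Ordinal iv)) := zB; rewrite [RHS]mxE => <-.
rewrite dotE mxE; apply: eq_bigr => j _.
by rewrite !mxE /= nth_index.
Qed.

(** A circle has more points than any finite set.  The rational
    parametrisation of the circle by natural numbers avoids square roots. *)
Lemma exists_unit_fresh d (u w : 'rV[R]_d) (L : seq 'rV[R]_d) :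
    dot u u = 1 -> dot w w = 1 -> dot u w = 0 ->
  exists a b, dot (a *: u + b *: w) (a *: u + b *: w) = 1
           /\ a *: u + b *: w \notin L.
Proof.
move=> uu ww uw.
pose a (n : nat) : R := (1 - n%:R ^+ 2) / (1 + n%:R ^+ 2).
pose b (n : nat) : R := (2 * n%:R) / (1 + n%:R ^+ 2).
pose z n := a n *: u + b n *: w.
have dz n : dot (z n) (z n) = a n ^+ 2 + b n ^+ 2.
  rewrite /z !(dotDl, dotDr, dotZl, dotZr) uu ww uw (dotC w u) uw; ring.
have den n : 1 + n%:R ^+ 2 != 0 :> R.
  by rewrite gt_eqF // ltr_wpDr ?sqr_ge0 ?ltr01.
have z1 n : dot (z n) (z n) = 1.
  by rewrite dz /a /b; have := den n; set t := n%:R => t0; field.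
(* The coordinate along [u] is 2 / (1 + n^2) - 1, decreasing in [n]. *)
have inj : injective z.
  move=> m n zmn; have : a m = a n.
    suff da k : dot (z k) u = a k by rewrite -!da zmn.
    by rewrite /z dotDl !dotZl uu (dotC w) uw mulr0 addr0 mulr1.
  have aE k : a k = 2 / (1 + k%:R ^+ 2) - 1.
    by rewrite /a; have := den k; set t := k%:R => t0; field.
  rewrite !aE => /addIr /(mulfI _) => /(_ (lt0r_neq0 (ltr0n _ 2))) /invr_inj /addrI.
  by move/eqP; rewrite eqrXn2 ?ler0n // eqr_nat => /eqP.
have [/hasP[n _ nL]|/hasPn h] := boolP (has (fun n => z n \notin L) (iota 0 (size L).+1)).
  exists (a n), (b n); split; [exact: z1|exact: nL].
suff : ((size L).+1 <= size L)%N by rewrite ltnn.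
rewrite -{1}(size_iota 0 (size L).+1) -(size_map z); apply: uniq_leq_size.
  by rewrite map_inj_uniq // iota_uniq.
by move=> _ /mapP[n nI ->]; have := h n nI; rewrite negbK.
Qed.

Definition rot90 (u : 'rV[R]_2) : 'rV[R]_2 :=
  \row_i (if i == 0 then - u 0 1 else u 0 0).

Lemma dot2E (u v : 'rV[R]_2) : dot u v = u 0 0 * v 0 0 + u 0 1 * v 0 1.
Proof. by rewrite dotE !big_ord_recl big_ord0 addr0; congr (_ + _ * _); congr (_ _ _); apply/val_inj. Qed.

Lemma dot_rot90 u : dot u (rot90 u) = 0.
Proof. rewrite dot2E !mxE /=; ring. Qed.

Lemma dot_rot90_rot90 u : dot (rot90 u) (rot90 u) = dot u u.
Proof. rewrite !dot2E !mxE /=; ring. Qed.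

Lemma rot90K u : rot90 (rot90 u) = - u.
Proof.
apply/rowP => i; rewrite !mxE /=; case: (eqVneq i 0) => [->|] //.
by case: i => -[|[|//]] ? // _; congr (- _ _ _); apply/val_inj.
Qed.

Lemma rot90N u : rot90 (- u) = - rot90 u.
Proof. by apply/rowP => i; rewrite !mxE; case: ifP; rewrite ?opprK. Qed.

End Dot.

(** * Orthonormal representations and the moves that extend them *)

Section Orthorep.
Variables (R : realType) (G : sgraph).
Implicit Types (S A B C K Y : {set G}) (x y u v w : G) (d : nat).

(** The function is defined on all vertices, but only its values on [S] matter;
    opposite vectors are allowed. *)
Definition orthorep S d := exists f : G -> 'rV[R]_d,
  [/\ {in S &, injective f}, {in S, forall x, dot (f x) (f x) = 1%R}
    & {in S &, forall x y, adj x y -> dot (f x) (f y) = 0%R}].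

Lemma orthorep_sub A S d : A \subset S -> orthorep S d -> orthorep A d.
Proof.
move=> /subsetP sAS [f [inj unit orth]]; exists f.
by split=> [x y|x|x y] /sAS ?; [move/sAS|..|move/sAS]; auto.
Qed.

Lemma orthorep_empty d : orthorep set0 d.
Proof. by exists (fun=> 0%R); split=> [x y|x|x y]; rewrite inE. Qed.

(** Vectors of two orthogonal summands are orthogonal and, being nonzero,
    distinct. *)
Lemma orthorep_join A B d1 d2 : orthorep A d1 -> orthorep B d2 -> orthorep (A :|: B) (d1 + d2).
Proof.
move=> [f [injf unitf orthf]] [g [injg unitg orthg]].
have nz d (z : 'rV[R]_d) : dot z z = 1%R -> z != 0%R.
  by apply: contra_eq_neq => ->; rewrite dot0l eq_sym oner_eq0.
exists (fun x => if x \in A then row_mx (f x) 0%R else row_mx 0%R (g x)).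
split=> [x y|x|x y]; rewrite !inE.
- case: (boolP (x \in A)) => xA /=; case: (boolP (y \in A)) => yA //= xB yB /eq_row_mx[].
  + by move=> + _; apply: injf.
  + by move=> f0 _; have := nz _ _ (unitf x xA); rewrite f0 eqxx.
  + by move=> _ /eqP; rewrite (negbTE (nz _ _ (unitg x xB))).
  + by move=> _; apply: injg.
- case: ifP => xA /= xB; rewrite dot_row dot0l ?addr0 ?add0r; [exact: unitf|exact: unitg].
- case: (boolP (x \in A)) => xA /=; case: (boolP (y \in A)) => yA //= xB yB axy;
    rewrite dot_row ?dot0l ?addr0 ?add0r.
  + exact: orthf.
  + by rewrite dotC dot0l.
  + by rewrite dotC dot0l.
  + exact: orthg.
Qed.

Lemma orthorep_nonadj_pair u v : ~~ adj u v -> orthorep [set u; v] 1.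
Proof.
move=> auv; exists (fun x => if x == u then const_mx 1%R else const_mx (-1)%R).
have neq : (const_mx 1 <> const_mx (-1) :> 'rV[R]_1)%R.
  move/matrixP/(_ ord0 ord0); rewrite !mxE => /eqP.
  by rewrite -subr_eq0 opprK -[(1 + 1)%R]/(2%:R)%R pnatr_eq0.
split=> [x y|x|x y]; rewrite !inE.
- move=> /orP[]/eqP-> /orP[]/eqP->; rewrite ?eqxx //; case: (v =P u) => // _.
  by move/esym.
- by move=> _; case: ifP => _; rewrite dotE big_ord1 !mxE ?mulr1 ?mulrNN ?mulr1.
- move=> /orP[]/eqP-> /orP[]/eqP->; rewrite ?adj_irrefl ?(negbTE auv) //.
  by rewrite adj_sym (negbTE auv).
Qed.

(** The pair takes the two opposite unit vectors of a new dimension. *)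
Lemma orthorep_add_nonadj S u v d : ~~ adj u v -> orthorep (S :\ u :\ v) d -> orthorep S d.+1.
Proof.
move=> auv /(orthorep_join (orthorep_nonadj_pair auv)); rewrite add1n; apply: orthorep_sub.
apply/subsetP => x xS; rewrite !inE xS andbT.
by case: (x == u); case: (x == v).
Qed.

Lemma orthorep_add1 S u d : orthorep (S :\ u) d -> orthorep S d.+1.
Proof.
move=> repS; apply: (@orthorep_add_nonadj _ u u); first by rewrite adj_irrefl.
by apply: orthorep_sub repS; exact: subsetDl.
Qed.

Lemma orthorep_small S d : #|S| <= d -> orthorep S d.
Proof.
elim: d S => [|d IHd] S; first by rewrite leqn0 cards_eq0 => /eqP->; exact: orthorep_empty.
have [->|[x xS]] := set_0Vmem S; first by move=> _; exact: orthorep_empty.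
by rewrite (cardsD1 x) xS ltnS => /IHd; exact: orthorep_add1.
Qed.

(** The orthogonal complement of the neighbours has dimension at least two, so
    its unit circle has a point that is not yet taken. *)
Lemma orthorep_add_low_degree S v d : deg S v + 2 <= d -> orthorep (S :\ v) d -> orthorep S d.
Proof.
move=> dv [f [inj unit orth]].
pose s := [seq f y | y <- enum [set y in S | adj v y]].
have szs : size s = deg S v by rewrite size_map -cardE.
have [|u uu us] := @exists_unit_orth R d s; first lia.
have [|w ww ws] := @exists_unit_orth R d (u :: s); first by rewrite /= szs; lia.
have uw : dot u w = 0%R by rewrite dotC ws ?mem_head.
have [a [b []]] := exists_unit_fresh [seq f y | y <- enum (S :\ v)] uu ww uw.
set z := (_ + _)%R => zz zL.
have zorth y : y \in S -> adj v y -> dot z (f y) = 0%R.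
  move=> yS avy; have fys : f y \in s by rewrite map_f // mem_enum inE yS.
  by rewrite dotDl !dotZl us // ws ?inE ?fys ?orbT // !mulr0 addr0.
have zfresh y : y \in S -> y != v -> z <> f y.
  by move=> yS yv zy; case/negP: zL; rewrite zy map_f // mem_enum !inE yv.
exists (fun x => if x == v then z else f x); split=> [x y|x|x y] /=.
- move=> xS yS; case: (eqVneq x v) => [->|xv]; case: (eqVneq y v) => [->|yv] //.
  + by move/zfresh => [].
  + by move/esym/zfresh => [].
  + by apply: inj; rewrite !inE ?xv ?yv.
- by move=> xS; case: ifP => // xv; rewrite unit // !inE xv.
- move=> xS yS; case: (eqVneq x v) => [->|xv]; case: (eqVneq y v) => [->|yv].
  + by rewrite adj_irrefl.
  + exact: zorth.
  + by rewrite adj_sym dotC; exact: zorth.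
  + by apply: orth; rewrite !inE ?xv ?yv.
Qed.

(** By removing vertices of low degree one by one, a hereditary property has to
    be treated only on sets of minimum degree at least d - 1. *)
Lemma orthorep_strip (P : {set G} -> Prop) d :
    (forall A S, A \subset S -> P S -> P A) ->
    (forall S, P S -> {in S, forall x, d <= (deg S x).+1} -> orthorep S d) ->
  forall S, P S -> orthorep S d.
Proof.
move=> subP coreP S; have [n] := ubnP #|S|; elim: n S => // n IHn S ltS PS.
have [|/forall_inPn[v vS lowv]] := boolP [forall x in S, d <= (deg S x).+1].
  by move/forall_inP; exact: coreP.
apply: (@orthorep_add_low_degree _ v); first by move: lowv; lia.
apply: IHn; last by apply: subP PS; exact: subsetDl.
by move: ltS; rewrite (cardsD1 v) vS.
Qed.

(** A union of components that is contained in the 4-cycle a b a' b' lies on an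
    orthonormal frame and its negative; the frame is turned until it meets none
    of the points already present.  Equalities among the four vertices are
    allowed, which covers the smaller components. *)
Lemma orthorep_add_component S a a' b b' :
    ~~ adj a a' -> ~~ adj b b' ->
    (forall x y, x \in [set a; a'; b; b'] -> y \in S :\: [set a; a'; b; b'] ->
       ~~ adj x y) ->
  orthorep (S :\: [set a; a'; b; b']) 2 -> orthorep S 2.
Proof.
set F := [set a; a'; b; b'] => naa nbb nout [f [inj unit orth]].
have [//|u0 uu0 _] := @exists_unit_orth R 2 [::].
have [//|w0 ww0 /(_ u0 (mem_head _ _)) wu0] := @exists_unit_orth R 2 [:: u0].
rewrite dotC in wu0.
(* [L4] contains every [z] for which one of the vectors [z], [- z], [rot90 z],
   [- rot90 z] is already taken. *)
pose L := [seq f y | y <- enum (S :\: F)].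
pose L4 := L ++ map (fun p : 'rV[R]_2 => - p)%R L ++ map (@rot90 R) L ++ map (fun p : 'rV[R]_2 => - rot90 p)%R L.
have [p [q []]] := exists_unit_fresh L4 uu0 ww0 wu0.
set u := (_ + _)%R => uu uL.
move: uL; rewrite !mem_cat !negb_or => /and4P[u1 u2 u3 u4].
have {}u2 : (- u)%R \notin L.
  by apply: contra u2 => uL; apply/mapP; exists (- u)%R; rewrite ?opprK.
have {}u4 : rot90 u \notin L.
  apply: contra u4 => uL; apply/mapP; exists (rot90 u) => //.
  by rewrite rot90K opprK.
have {}u3 : (- rot90 u)%R \notin L.
  apply: contra u3 => uL; apply/mapP; exists (- rot90 u)%R => //.
  by rewrite rot90N rot90K opprK.
have ur : dot u (rot90 u) = 0%R by exact: dot_rot90.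
have ru : dot (rot90 u) u = 0%R by rewrite dotC.
have rr : dot (rot90 u) (rot90 u) = 1%R by rewrite dot_rot90_rot90.
have neq1 (z1 z2 : 'rV[R]_2) : dot z1 z1 = 1%R -> dot z1 z2 = 0%R -> z1 <> z2.
  by move=> zz + zE; rewrite -zE zz => /eqP; rewrite oner_eq0.
have neqN (z1 : 'rV[R]_2) : dot z1 z1 = 1%R -> z1 <> (- z1)%R.
  move=> zz /(congr1 (dot z1)); rewrite dotNr zz => /eqP.
  by rewrite -addr_eq0 -[(1 + 1)%R]/(2%:R)%R pnatr_eq0.
pose g x := if x == a then u else if x == a' then (- u)%R
   else if x == b then rot90 u else (- rot90 u)%R.
have unitg x : dot (g x) (g x) = 1%R.
  by rewrite /g; do !case: ifP => _; rewrite ?dotNl ?dotNr ?opprK.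
have gL x : g x \notin L by rewrite /g; do !case: ifP => _.
have fL y : y \in S -> y \notin F -> f y \in L.
  by move=> yS yF; rewrite map_f // mem_enum in_setD yF.
have gF x : x \in F -> [\/ x = a /\ g x = u, x = a' /\ g x = (- u)%R,
    x = b /\ g x = rot90 u | x = b' /\ g x = (- rot90 u)%R].
  rewrite !inE /g; case: eqP => [->|_] /=; first by constructor 1.
  case: eqP => [->|_] /=; first by constructor 2.
  case: eqP => [->|_] /=; first by constructor 3.
  by move/eqP->; constructor 4.
have rN : dot (rot90 u) (- u)%R = 0%R by rewrite dotNr ru oppr0.
have uN : dot u (- rot90 u)%R = 0%R by rewrite dotNr ur oppr0.
have Nr : dot (- u)%R (rot90 u) = 0%R by rewrite dotNl ur oppr0.
have Nu : dot (- rot90 u)%R u = 0%R by rewrite dotNl ru oppr0.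
have NN : dot (- u)%R (- u)%R = 1%R by rewrite dotNl dotNr opprK.
have Nr1 : dot (- rot90 u)%R (- rot90 u)%R = 1%R by rewrite dotNl dotNr opprK.
have NNr : dot (- u)%R (- rot90 u)%R = 0%R by rewrite dotNl uN oppr0.
have NrN : dot (- rot90 u)%R (- u)%R = 0%R by rewrite dotC.
have injg : {in F &, injective g}.
  move=> x y xF yF; case: (gF x xF) => -[-> ->]; case: (gF y yF) => -[-> ->] //;
    first [ by move/neq1 => h; case: h | by move/neqN => h; case: h
          | by move/esym/neqN => h; case: h].
have orthg : {in F &, forall x y, adj x y -> dot (g x) (g y) = 0%R}.
  move=> x y xF yF; case: (gF x xF) => -[-> ->]; case: (gF y yF) => -[-> ->] //;
  by rewrite ?adj_irrefl ?(negbTE naa) ?(negbTE nbb) // adj_sym ?(negbTE naa) ?(negbTE nbb).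
exists (fun x => if x \in F then g x else f x); split=> [x y|x|x y] xS.
- move=> yS; case: ifPn => xF; case: ifPn => yF.
  + exact: injg.
  + by move=> gf; have := gL x; rewrite gf fL.
  + by move=> gf; have := gL y; rewrite -gf fL.
  + by apply: inj; rewrite in_setD ?xF ?yF.
- by case: ifPn => xF //; rewrite unit // in_setD xF.
- move=> yS; case: ifPn => xF; case: ifPn => yF axy.
  + exact: orthg.
  + by have := nout x y; rewrite in_setD xF yF yS axy => /(_ isT isT).
  + by have := nout y x; rewrite in_setD xF yF xS adj_sym axy => /(_ isT isT).
  + by rewrite orth // in_setD ?xF ?yF.
Qed.

(** * Representations of small and sparse graphs *)

(** The components are paths with at most four vertices, since a longer path or
    a cycle has three vertices of degree 2.  Each is split off by
    [orthorep_add_component]. *)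
Lemma orthorep2_sparse S : {in S, forall x, deg S x <= 2} ->
  #|[set x in S | 1 < deg S x]| <= 2 -> orthorep S 2.
Proof.
have [n] := ubnP #|S|; elim: n S => // n IHn S ltS deg2 few.
have IH (F : {set G}) : {subset F <= S} -> F != set0 -> orthorep (S :\: F) 2.
  move=> /subsetP sFS F0; apply: IHn.
  - by move: ltS F0; rewrite -card_gt0 -(cardsID F S) (setIidPr sFS); lia.
  - move=> x; rewrite inE => /andP[_ xS]; apply: leq_trans (deg2 x xS).
    exact/deg_sub/subsetDl.
  - apply: leq_trans few; apply/subset_leq_card/subsetP => x; rewrite !inE.
    move=> /andP[/andP[_ ->]] /leq_trans; apply; exact/deg_sub/subsetDl.
have few3 x y z : x \in S -> y \in S -> z \in S -> x != y -> x != z -> y != z ->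
    1 < deg S x -> 1 < deg S y -> 1 < deg S z -> False.
  move=> xS yS zS xy xz yz dx dy dz.
  have : #|[set x; y; z]| <= 2.
    apply: leq_trans few; apply/subset_leq_card/subsetP => t; rewrite !inE.
    by move=> /orP[/orP[]|] /eqP->; rewrite ?xS ?yS ?zS.
  by rewrite -setUA cardsU1 !inE negb_or xy xz cards2 yz.
have comp a a' b b' : a \in S -> a' \in S -> b \in S -> b' \in S ->
    ~~ adj a a' -> ~~ adj b b' ->
    {in S, forall y, [|| adj a y, adj a' y, adj b y | adj b' y] ->
       y \in [set a; a'; b; b']} -> orthorep S 2.
  move=> aS a'S bS b'S naa nbb out.
  apply: (orthorep_add_component naa nbb); last first.
    apply: IH; last by apply/set0Pn; exists a; rewrite !inE eqxx.
    by move=> x; rewrite !inE -!orbA => /or4P[]/eqP->.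
  move=> x y xF; rewrite in_setD => /andP[yF yS]; apply: contra yF => axy.
  apply: out => //; move: xF; rewrite !inE -!orbA.
  by case/or4P => /eqP <-; rewrite axy ?orbT.
(* The component of a vertex [x] of degree 2 is a path y - x - z or
   y - x - z - w, where [y] is chosen to have degree 1. *)
have [/exists_inP[x xS dx]|/exists_inPn no2] := boolP [exists x in S, 1 < deg S x].
  have /cards2P[y [z [yz Nx]]] : #|[set y in S | adj x y]| == 2.
    by rewrite eqn_leq deg2.
  have {}Nx t : (t \in S) && adj x t = (t == y) || (t == z).
    by have /setP/(_ t) := Nx; rewrite !inE.
  wlog dy : y z yz Nx / deg S y <= 1.
    move=> W; have [dy|dy] := leqP (deg S y) 1; first exact: (W y z).
    apply: (W z y); rewrite 1?eq_sym //; first by move=> t; rewrite Nx orbC.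
    have /andP[yS xy] : (y \in S) && adj x y by rewrite Nx eqxx.
    have /andP[zS xz] : (z \in S) && adj x z by rewrite Nx eqxx orbT.
    rewrite leqNgt; apply/negP => dz; apply: (few3 x y z) => //.
      by apply: contraTneq xy => ->; rewrite adj_irrefl.
    by apply: contraTneq xz => ->; rewrite adj_irrefl.
  have /andP[yS xy] : (y \in S) && adj x y by rewrite Nx eqxx.
  have /andP[zS xz] : (z \in S) && adj x z by rewrite Nx eqxx orbT.
  have nxz : x != z by apply: contraTneq xz => ->; rewrite adj_irrefl.
  have Ny t : t \in S -> adj y t -> t = x.
    by move=> tS; apply: (deg_le1_nbr dy) => //; rewrite adj_sym.
  have nyz : ~~ adj y z.
    by apply: contraNN nxz => /Ny -> //.
  have [dz|dz] := leqP (deg S z) 1.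
    apply: (comp x x y z) => //; first by rewrite adj_irrefl.
    move=> t tS; rewrite !inE => /or4P[].
    - by have := Nx t; rewrite tS => /= -> /orP[]->; rewrite ?orbT.
    - by have := Nx t; rewrite tS => /= -> /orP[]->; rewrite ?orbT.
    - by move/Ny->; rewrite ?eqxx.
    - move=> zt; rewrite (@deg_le1_nbr _ S z x t) ?eqxx //.
      by rewrite adj_sym.
  have [w] : exists w, w \in [set t in S | adj z t] :\ x.
    by apply/set0Pn; rewrite -card_gt0 -(deg_rem_self S z) in dz *;
      move: dz; rewrite deg_rem_self /deg (cardsD1 x); case: (_ \in _); lia.
  rewrite !inE => /and3P[wx wS zw].
  have nzw : z != w by apply: contraTneq zw => ->; rewrite adj_irrefl.
  have dw : deg S w <= 1.
    by rewrite leqNgt; apply/negP => dw; apply: (few3 x z w) => //; rewrite eq_sym.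
  apply: (comp x w y z) => //.
    apply/negP => xw; have := Nx w; rewrite wS xw => /esym/orP[]/eqP wE.
      by move: nyz; rewrite -wE adj_sym zw.
    by move: nzw; rewrite wE eqxx.
  move=> t tS; rewrite !inE => /or4P[].
  - by have := Nx t; rewrite tS => /= -> /orP[]->; rewrite ?orbT.
  - by move=> wt; rewrite (@deg_le1_nbr _ S w z t) ?eqxx ?orbT // adj_sym.
  - by move/Ny->; rewrite ?eqxx.
  - move=> zt; have := @deg_le2_nbr _ S z x w t (deg2 _ zS) xS wS.
    by rewrite eq_sym wx adj_sym xz zw tS zt !inE => /(_ isT isT isT isT isT) ->.
have {}no2 x : x \in S -> deg S x <= 1 by move/no2; rewrite -leqNgt.
have [->|[x xS]] := set_0Vmem S; first exact: orthorep_empty.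
have [/exists_inP[y yS xy]|/exists_inPn nox] := boolP [exists y in S, adj x y].
  apply: (comp x x y y); rewrite ?adj_irrefl // => t tS; rewrite !inE !orbA !orbb.
  rewrite -orbA orbb => /orP[xt|yt].
    by rewrite (@deg_le1_nbr _ S x y t) ?eqxx ?orbT // no2.
  by rewrite (@deg_le1_nbr _ S y x t) ?eqxx ?orbT ?no2 // adj_sym.
apply: (comp x x x x); rewrite ?adj_irrefl // => t tS.
by rewrite !orbb => xt; have := nox t tS; rewrite xt.
Qed.

Lemma orthorep2_degsum_le5 S : degsum S <= 5 -> orthorep S 2.
Proof.
move=> D5; apply: orthorep2_sparse => [x xS|].
  by have := degsum_rem xS; move: D5; lia.
rewrite -(leq_pmul2l (isT : 0 < 2)); suff : 2 * #|[set x in S | 1 < deg S x]| <= degsum S by lia.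
rewrite mulnC -sum_nat_const /degsum [leqRHS](big_setID [set x in S | 1 < deg S x]).
apply: leq_trans (leq_addr _ _); rewrite /= (setIidPr _); last first.
  by apply/subsetP => x; rewrite inE => /andP[].
by apply: leq_sum => x; rewrite inE => /andP[].
Qed.

(** The degrees are 1, except for at most one vertex of degree 2. *)
Lemma orthorep2_five S : #|S| = 5 -> degsum S <= 6 -> {in S, forall x, 0 < deg S x} ->
  orthorep S 2.
Proof.
move=> S5 D6 pos; apply: orthorep2_sparse => [x xS|].
  move: D6; rewrite /degsum (big_setD1 x) //= => D6.
  have : \sum_(y in S :\ x) 1 <= \sum_(y in S :\ x) deg S y.
    by apply: leq_sum => y; rewrite inE => /andP[_ /pos].
  by rewrite sum1_card; move: S5; rewrite (cardsD1 x) xS; lia.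
have : \sum_(x in S) (1 + (1 < deg S x)) <= degsum S.
  by apply: leq_sum => x /pos; case: (deg S x) => [|[|k]].
rewrite big_split /= sum1_card S5.
have -> : \sum_(x in S) (1 < deg S x) = #|[set x in S | 1 < deg S x]|.
  rewrite -sum1_card big_mkcond [RHS]big_mkcond /=; apply: eq_bigr => x _.
  by rewrite inE; case: (x \in S); case: (_ < _).
lia.
Qed.

(** Two disjoint nonadjacent pairs save the two dimensions in excess.  Let
    [u], [v] be nonadjacent and [K] the rest, a d-clique.  Neither of [u], [v]
    is adjacent to all of [K], or there would be a (d+1)-clique.  If the
    nonneighbours cannot be chosen distinct, both are one vertex [a], and
    [K :\ a] is joined to [u], [v], [a]. *)
Lemma orthorep_card_le_add2 S d : 1 < d -> #|S| <= d.+2 ->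
  ~~ has_join S d.+1 0 -> ~~ has_join S d.-1 3 -> orthorep S d.
Proof.
case: d => [|[|d]] // _ Sd noK noJ.
have [Sle|Sgt] := leqP #|S| d.+2; first exact: orthorep_small.
have [u [v [uS vS uv nuv]]] := nonadj_exists noK Sgt.
have := card_rem2 uS vS uv; set K := S :\ u :\ v => cK.
have inK x : (x \in K) = [&& x != v, x != u & x \in S] by rewrite !inE.
have uK : u \notin K by rewrite inK eqxx andbF.
have vK : v \notin K by rewrite inK eqxx.
have sKS : K \subset S by apply: subset_trans (subsetDl _ _) (subsetDl _ _).
have repK : orthorep K d.+1 -> orthorep S d.+2 by exact: orthorep_add_nonadj.
move: K cK inK uK vK sKS repK => K cK inK uK vK sKS repK.
have [Kle|Kgt] := leqP #|K| d.+1; first by apply: repK; exact: orthorep_small.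
have Kd : #|K| = d.+2 by move: Sd cK Kgt; clear; lia.
have [[a [b [aK bK ab nab]]]|domK] := nonadj_or_clique K.
  apply/repK/(orthorep_add_nonadj nab)/orthorep_small.
  by move: (card_rem2 aK bK ab) Kd; clear; lia.
have /dominatesP[_ adjK] := domK.
have ex p : p \in S -> p \notin K -> exists2 a, a \in K & ~~ adj p a.
  move=> pS pK; apply/exists_inP; apply: contraNT noK => /exists_inPn allp.
  have sub : p |: K \subset S by rewrite subUset sub1set pS.
  apply: (has_join_sub sub); apply: clique_has_join; last by rewrite cardsU1 pK Kd.
  by apply: clique_add => // a /allp; rewrite negbK.
have [a aK nua] := ex u uS uK.
have [b bK nvb] := ex v vS vK.
have two x y : x \in K -> y \in K -> x != y -> ~~ adj u x -> ~~ adj v y -> orthorep S d.+2.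
  move=> xK yK xy nux nvy.
  apply/(orthorep_add_nonadj nux)/(orthorep_add_nonadj nvy)/orthorep_small.
  have := xK; rewrite inK => /and3P[xv xu xS]; have := yK; rewrite inK => /and3P[yv yu yS].
  have ux : u != x by rewrite eq_sym.
  have vy : v != y by rewrite eq_sym.
  have vS' : v \in S :\ u :\ x by rewrite !in_setD1 eq_sym xv eq_sym uv.
  have yS' : y \in S :\ u :\ x by rewrite !in_setD1 eq_sym xy yu.
  by move: (card_rem2 uS xS ux) (card_rem2 vS' yS' vy) cK Kd; clear; lia.
have [/existsP[x /and3P[xK xb nux]]|/existsPn onlyb] :=
    boolP [exists x, [&& x \in K, x != b & ~~ adj u x]]; first exact: (two x b).
have [/existsP[y /and3P[yK ya nvy]]|/existsPn onlya] :=
    boolP [exists y, [&& y \in K, y != a & ~~ adj v y]].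
  by apply: (two a y) => //; rewrite eq_sym.
have ab : a = b by apply/eqP; have := onlyb a; rewrite aK nua andbT negbK.
case/negP: noJ; apply/has_joinP; exists (K :\ a), S; split=> //; last 2 first.
- by move: Kd; rewrite (cardsD1 a) aK; clear; lia.
- by rewrite cK Kd; clear; lia.
apply/dominatesP; split; first exact: subset_trans (subsetDl _ _) sKS.
move=> x y; rewrite in_setD1 => /andP[xa xK] yS xy.
have [yK|yK] := boolP (y \in K); first exact: adjK.
rewrite adj_sym; move: yK; rewrite inK yS andbT negb_and !negbK => /orP[]/eqP->.
  by have := onlya x; rewrite xK xa /= negbK.
by have := onlyb x; rewrite xK -ab xa /= negbK.
Qed.

(** After removal of the vertices of degree at most 1, a graph with six edges
    has at most six vertices.  If it has six, any nonadjacent pair meets four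
    of the edges and the other two fit into a plane. *)
Lemma orthorep3_degsum_le12 S : degsum S <= 12 -> ~~ has_join S 4 0 -> orthorep S 3.
Proof.
move=> D12 noK.
apply: (orthorep_strip (P := fun S => degsum S <= 12 /\ ~~ has_join S 4 0)) => //.
  move=> A B sAB [DB nB]; split; first exact: leq_trans (degsum_sub sAB) DB.
  exact: contra (has_join_sub sAB) nB.
move=> {D12 noK} {}S [D12 noK] core; have [S5|S6] := leqP #|S| 5.
  apply: orthorep_card_le_add2 => //; apply/negP => /has_join_degsum.
  by move: D12; clear; lia.
have [u [v [uS vS uv nuv]]] := nonadj_exists noK (leq_trans (isT : 4 <= 6) S6).
apply/(orthorep_add_nonadj nuv)/orthorep2_degsum_le5.
by move: (degsum_rem2 uS vS uv nuv) (core u uS) (core v vS) D12; clear; lia.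
Qed.

(** The graph is 2-regular.  Two nonadjacent vertices without common neighbour
    exist, as at most five vertices have distance at most 2 from a given one.
    Removing them leaves three edges on five vertices, none of them isolated,
    and this fits into a plane ([orthorep2_five]). *)
Lemma orthorep3_seven S : #|S| = 7 -> degsum S <= 14 ->
  {in S, forall x, 2 <= deg S x} -> orthorep S 3.
Proof.
move=> S7 D14 ge2.
have deg2 x : x \in S -> deg S x = 2.
  move=> xS; have := degsum_ge_one xS ge2; have := ge2 x xS.
  by move: D14; rewrite S7; clear; lia.
have [u uS] : exists u, u \in S by apply/set0Pn; rewrite -card_gt0 S7.
pose N x := [set y in S | adj x y].
have cN x : x \in S -> #|N x| = 2 by exact: deg2.
have /eqP/cards2P[p [q [pq Nu]]] := cN u uS.
have /setIdP[pS up] : p \in N u by rewrite Nu !inE eqxx.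
have /setIdP[qS uq] : q \in N u by rewrite Nu !inE eqxx orbT.
have cNu x : x \in S -> adj u x -> #|N x :\ u| = 1.
  move=> xS ux; have := cN x xS; rewrite (cardsD1 u) inE uS adj_sym ux /=.
  by clear; lia.
(* The vertices at distance at most 2 from [u]. *)
pose near := [set u] :|: N u :|: (N p :\ u) :|: (N q :\ u).
have /subsetPn[v vS] : ~~ (S \subset near).
  apply/negP => /subset_leq_card; rewrite S7 leqNgt => /negP[].
  rewrite /near; have := (leq_card_setU ([set u] :|: N u :|: (N p :\ u)) (N q :\ u)).1.
  have := (leq_card_setU ([set u] :|: N u) (N p :\ u)).1.
  have := (leq_card_setU [set u] (N u)).1.
  by rewrite cards1 cN // !cNu //; clear; lia.
rewrite !inE !negb_or vS /= => /andP[/andP[/andP[vu nuv] nvp] nvq].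
have uv : u != v by rewrite eq_sym.
apply: (orthorep_add_nonadj nuv); apply: orthorep2_five.
- by move: (card_rem2 uS vS uv); rewrite S7; clear; lia.
- by move: (degsum_rem2 uS vS uv nuv) D14; rewrite !deg2 //; clear; lia.
move=> x; rewrite !inE => /and3P[xv xu xS].
have := deg2 x xS; rewrite (deg_rem S x u) (deg_rem (S :\ u) x v) uS in_setD1 vu vS /=.
case xux: (adj x u) => /=; last by case: (adj x v); clear; lia.
suff -> : adj x v = false by clear; lia.
apply/negbTE; have : x \in N u by rewrite inE xS adj_sym.
rewrite Nu => /set2P[]->.
  by move: nvp; rewrite vu.
by move: nvq; rewrite vu.
Qed.

(** These are six vertices of a graph in R^4 that has a seventh one adjacent to
    all of them.  Either a second vertex is adjacent to all the rest, and its
    removal leaves at most three edges on five vertices; or the degrees are 2 and 3 and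
    a nonadjacent pair is removed that contains a vertex of degree 3 if there
    is one, so that at most two edges are left. *)
Lemma orthorep3_six S : #|S| = 6 -> degsum S <= 16 ->
    {in S, forall x, 2 <= deg S x} -> ~~ has_join S 4 0 ->
    {in S &, forall u v, u != v -> ~~ adj u v -> deg S u + deg S v <= 5} ->
  orthorep S 3.
Proof.
move=> S6 D16 ge2 noK le5.
have [/exists_inP[b bS b4]|/exists_inPn no4] := boolP [exists b in S, 4 <= deg S b].
  have b5 : deg S b = 5.
    have := deg_lt_card bS; rewrite S6 ltnS => b5.
    apply/eqP; rewrite eqn_leq b5 leqNgt; apply/negP => lt5.
    have [|v [vS bv nbv]] := nonneighbour_exists bS; first by rewrite S6.
    by have := le5 b v bS vS bv nbv; move: (ge2 v vS) b4; clear; lia.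
  apply: (@orthorep_add1 _ b); apply: orthorep2_five.
  - by move: S6; rewrite (cardsD1 b) bS; clear; lia.
  - by move: (degsum_rem bS) D16; rewrite b5; clear; lia.
  - move=> x /setD1P[_ xS]; have := ge2 x xS; have := leq_deg_rem S x b.
    by clear; lia.
have {}no4 x : x \in S -> deg S x <= 3 by move/no4; rewrite -ltnNge.
pose X := [set x in S | 2 < deg S x].
have cX : #|X| <= 3.
  rewrite leqNgt; apply: contra noK => X4.
  have sXS : X \subset S by apply/subsetP => x; rewrite inE => /andP[].
  apply: (has_join_sub sXS); apply: clique_has_join X4.
  apply/dominatesP; split=> // x y; rewrite !inE => /andP[xS dx] /andP[yS dy] xy.
  by apply: contraT => /(le5 x y xS yS xy); move: dx dy; clear; lia.
have D12 : degsum S <= 12 + #|X|.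
  have <- : \sum_(x in S) (2 + (x \in X)) = 12 + #|X|.
    rewrite big_split /= sum_nat_const S6; congr (_ + _).
    rewrite -sum1_card big_mkcond [RHS]big_mkcond /=; apply: eq_bigr => x _.
    by rewrite inE; case: (x \in S); case: (_ < _).
  apply: leq_sum => x xS; rewrite inE xS.
  by have := no4 x xS; case: (ltnP 2) => /=; clear; lia.
suff [u [v [uS vS uv nuv D5]]] : exists u v,
    [/\ u \in S, v \in S, u != v, ~~ adj u v & degsum S <= 5 + 2 * (deg S u + deg S v)].
  apply/(orthorep_add_nonadj nuv)/orthorep2_degsum_le5.
  by move: (degsum_rem2 uS vS uv nuv) D5; clear; lia.
have [X0|[u]] := set_0Vmem X.
  have [|u [v [uS vS uv nuv]]] := nonadj_exists noK; first by rewrite S6.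
  exists u, v; split=> //; move: D12 (ge2 u uS) (ge2 v vS).
  by rewrite X0 cards0; clear; lia.
rewrite inE => /andP[uS du].
have [|v [vS uv nuv]] := nonneighbour_exists uS; first by rewrite S6 /= ltnS; exact: leq_trans (no4 u uS) _.
by exists u, v; split=> //; move: (ge2 v vS) D12 cX; clear -du; lia.
Qed.

(** * Graphs with few edges on the sphere *)

(** Cut S into two parts so that few edges stay inside.  Counting the edges
    within the clique [X] of degree-4 vertices twice makes a maximum cut spread
    [X] evenly: inside its part a vertex outside [X] keeps degree at most 1, a
    vertex of [X] keeps degree at most 2, and no part contains three vertices
    of degree 2.  Each part then fits into a plane. *)
Lemma orthorep4_clique_excess S : {in S, forall x, deg S x <= 4} ->
    {in [set x in S | 3 < deg S x] &, forall x y, x != y -> adj x y} ->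
  ~~ has_join S 5 0 -> orthorep S 4.
Proof.
set X := [set x in S | 3 < deg S x] => deg4 cliX noK.
have sXS : X \subset S by apply/subsetP => x; rewrite inE => /andP[].
have domX B : dominates (X :&: B) (X :&: B).
  apply/dominatesP; split=> // x y /setIP[xX _] /setIP[yX _]; exact: cliX.
have cX : #|X| <= 4.
  rewrite leqNgt; apply: contra noK => X5; apply: (has_join_sub sXS).
  by apply: clique_has_join X5; have := domX X; rewrite setIid.
(* Weight 2 for the edges inside [X], 1 for the other edges of [S]. *)
pose w x y := [&& x \in S, y \in S & adj x y] * (1 + ((x \in X) && (y \in X))).
have [x y|x|A stA] := @exists_stable_cut _ w.
- by rewrite /w adj_sym [(x \in X) && _]andbC andbCA.
- by rewrite /w adj_irrefl !andbF.
pose B b := [set x in S | (x \in A) == b].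
have wE x b : x \in S -> \sum_(y | (y \in A) == b) w x y =
    deg (B b) x + (x \in X) * deg (X :&: B b) x.
  move=> xS; rewrite !deg_sumE big_distrr /= -big_split /=.
  rewrite big_mkcond; apply: eq_bigr => y _; rewrite /w in_setI !in_set xS /=.
  by case: (y \in S); case: (y \in A); case: b; case: (adj x y); case: (3 < _); case: (_ < _).
have degB x b : deg (B b) x + deg (B (~~ b)) x = deg S x.
  rewrite !deg_sumE -big_split /=; apply: eq_bigr => y _; rewrite !in_set.
  by case: (y \in S); case: (y \in A); case: b; rewrite /= ?addn0.
have stable x b : x \in B b ->
    deg (B b) x + (x \in X) * deg (X :&: B b) x
      <= deg (B (~~ b)) x + (x \in X) * deg (X :&: B (~~ b)) x.
  rewrite inE => /andP[xS /eqP xb]; rewrite -!wE // -xb.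
  apply: leq_trans (stA x) _; apply: eq_leq; apply: eq_bigl => y.
  by case: (y \in A); case: (x \in A).
have notX x : x \in S -> x \notin X -> deg S x <= 3.
  by move=> xS; rewrite inE xS -leqNgt.
have inner x b : x \in B b -> deg (B b) x <= 1 + (x \in X).
  move=> xB; have := stable x b xB; have := degB x b.
  have xS : x \in S by move: xB; rewrite inE => /andP[].
  have := deg4 x xS; have := notX x xS.
  have : deg (X :&: B (~~ b)) x <= deg (B (~~ b)) x by exact/deg_sub/subsetIr.
  by case: (x \in X); clear; lia.
have splitX b : #|X :&: B b| + #|X :&: B (~~ b)| = #|X|.
  rewrite -(cardsID (B b) X); congr (_ + _); apply: eq_card => y; rewrite !in_set.
  by case: (y \in S); case: (_ < _); case: (y \in A); case: b.
have repB b : orthorep (B b) 2.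
  apply: orthorep2_sparse => [x /inner|]; first by case: (x \in X); clear; lia.
  rewrite leqNgt; apply/negP => big.
  have sub : [set x in B b | 1 < deg (B b) x] \subset X :&: B b.
    apply/subsetP => x; rewrite inE => /andP[xB dx]; rewrite inE xB andbT.
    by move: dx; rewrite ltnNge; apply: contraNT => xX; have := inner x b xB; rewrite (negbTE xX).
  have XB3 := leq_trans big (subset_leq_card sub).
  have [x xXB] : exists x, x \in X :&: B b by apply/set0Pn; rewrite -card_gt0; exact: leq_trans XB3.
  have /setIP[xX xB] := xXB.
  (* A vertex of [X] with two neighbours from [X] in its part has weight 4
     inside, and at most 3 outside as [X] has at most four elements. *)
  have := stable x b xB; have := inner x b xB; rewrite xX !mul1n.
  have := deg_sub x (subsetIr X (B b)); rewrite (deg_dominates (domX _) xXB).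
  have := deg_le_card (X :&: B (~~ b)) x; have := degB x b.
  have := deg4 x (subsetP sXS x xX).
  have := splitX b.
  by move: XB3 cX; clear; lia.
apply: orthorep_sub (orthorep_join (repB true) (repB false)).
by apply/subsetP => x xS; rewrite !in_set xS; case: (x \in A).
Qed.

(** The base of the induction on the dimension.  A nonadjacent pair of degree
    sum at least 8 leaves at most six edges, and R^3 has room for them.  If
    there is none, a vertex of degree at least 5 has no nonneighbour, as that
    would have degree at least 3, and any two vertices of degree 4 are adjacent. *)
Lemma orthorep4_degsum_lt30 S : degsum S < 30 ->
  ~~ has_join S 5 0 -> ~~ has_join S 3 3 -> orthorep S 4.
Proof.
move=> D30 noK noJ; apply: (orthorep_strip (P := fun S =>
  [/\ degsum S < 30, ~~ has_join S 5 0 & ~~ has_join S 3 3])) => //.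
  move=> A B sAB [DB nB nB']; split; first exact: leq_ltn_trans (degsum_sub sAB) DB.
    exact: contra (has_join_sub sAB) nB.
  exact: contra (has_join_sub sAB) nB'.
move=> {D30 noK noJ} {}S [D30 noK noJ] core.
have D28 : degsum S <= 28.
  rewrite leqNgt; apply/negP => D28; have := degsum_even S.
  by have -> : degsum S = 29 by move: D28 D30; clear; lia.
have ge3 x : x \in S -> 3 <= deg S x by exact: core.
have [S6|S7] := leqP #|S| 6; first exact: orthorep_card_le_add2.
have [/exists_inP[u uS /exists_inP[v vS /and3P[uv nuv sum8]]]|le7] :=
  boolP [exists u in S, exists v in S,
          [&& u != v, ~~ adj u v & 8 <= deg S u + deg S v]].
  have D12 : degsum (S :\ u :\ v) <= 12.
    by move: (degsum_rem2 uS vS uv nuv) sum8 D28; clear; lia.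
  apply: (orthorep_add_nonadj nuv); apply: orthorep3_degsum_le12 => //.
  (* A 4-clique would use up all six edges, but there is a fifth vertex, and it
     is not isolated. *)
  apply/negP => K4; have := @has_join_degsum_out _ _ 4 0 1 K4.
  have c5 : 4 < #|S :\ u :\ v| by move: (card_rem2 uS vS uv) S7; clear; lia.
  have ge1 : {in S :\ u :\ v, forall x, 1 <= deg (S :\ u :\ v) x}.
    by move=> x /setD1P[_ /setD1P[_ xS]]; move: (leq_deg_rem2 S u v x) (ge3 x xS); clear; lia.
  by move=> /(_ c5 ge1); move: D12; clear; lia.
have {}le7 : {in S &, forall u v, u != v -> ~~ adj u v -> deg S u + deg S v <= 7}.
  move=> u v uS vS uv nuv; rewrite leqNgt; apply: contra le7 => sum8.
  by apply/exists_inP; exists u => //; apply/exists_inP; exists v; rewrite // uv nuv.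
have [/exists_inP[a aS a5]|/exists_inPn no5] := boolP [exists a in S, 5 <= deg S a].
  have da : deg S a = #|S|.-1.
    have := deg_lt_card aS; case: (ltnP (deg S a) #|S|.-1); last by clear; lia.
    move/(nonneighbour_exists aS) => [v [vS av nav]].
    by have := le7 a v aS vS av nav; move: (ge3 v vS) a5; clear; lia.
  apply: (@orthorep_add1 _ a).
  have cS : #|S| = #|S :\ a|.+1 by rewrite (cardsD1 a) aS.
  have domA : {in S, forall v, a != v -> adj a v}.
    move=> v vS av; apply: contraT => nav.
    by have := le7 a v aS vS av nav; move: (ge3 v vS) a5; clear; lia.
  have degS x : x \in S :\ a -> deg S x = (deg (S :\ a) x).+1.
    move=> /setD1P[xa xS]; rewrite (deg_rem S x a) aS adj_sym domA 1?eq_sym //.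
    by rewrite addn1.
  have ge2 : {in S :\ a, forall x, 2 <= deg (S :\ a) x}.
    by move=> x xSa; have /setD1P[_ xS] := xSa; have := ge3 x xS; rewrite (degS x xSa).
  have := degsum_rem aS; rewrite da cS /= => DS.
  have := degsum_ge ge2.
  (* At most 14 edges and minimum degree 3 leave 6 or 7 vertices beside [a]. *)
  have [S8|Sne8] := eqVneq #|S :\ a| 7; first by move=> _; apply: orthorep3_seven => //; move: DS D28; rewrite S8; clear; lia.
  move=> D2; have S6 : #|S :\ a| = 6 by move: Sne8 S7 DS D2 D28; rewrite cS; clear; lia.
  apply: orthorep3_six => //.
  - by move: DS D28; rewrite S6; clear; lia.
  - apply: contra noK => /has_clique[Y [domY sYS cY]].
    have aY : a \notin Y by apply/negP => /(subsetP sYS); rewrite !inE eqxx.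
    apply/(has_join_sub (A := a |: Y)).
      by rewrite subUset sub1set aS (subset_trans sYS) ?subsetDl.
    apply: clique_has_join; last by rewrite cardsU1 aY cY.
    apply: clique_add => // y /(subsetP sYS); rewrite !inE => /andP[ya yS].
    by apply: domA; rewrite // eq_sym.
  - move=> u v uS vS uv nuv; have := le7 u v; rewrite !degS //.
    have /setD1P[_ uS'] := uS; have /setD1P[_ vS'] := vS.
    by move/(_ uS' vS' uv nuv); clear; lia.
apply: orthorep4_clique_excess => //.
- by move=> x /no5; rewrite -ltnNge.
- move=> x y; rewrite !inE => /andP[xS dx] /andP[yS dy] xy.
  by apply: contraT => /(le7 x y xS yS xy); move: dx dy; clear; lia.
Qed.

(** Beyond d + 2 vertices any nonadjacent pair may be removed for d >= 6.  In
    dimension d - 1 a clique [K_d] that survives leaves out a vertex of degree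
    at least d - 3, and at most 2 edges are left for it; [K_(d+1) - K_3] has
    too many edges.  For d = 5 these counts are tight, and either a ninth
    vertex or the choice of the pair gives the missing edges. *)
Lemma orthorep_few_edges d S : 3 < d -> degsum S < (d + 2) * (d + 1) ->
  ~~ has_join S d.+1 0 -> ~~ has_join S d.-1 3 -> orthorep S d.
Proof.
case: d => [|[|[|[|d]]]] // _; elim: d S => [|d IHd] S; first exact: orthorep4_degsum_lt30.
set e := d.+1.+4; pose P S := [/\ degsum S < (e + 2) * (e + 1),
  ~~ has_join S e.+1 0 & ~~ has_join S e.-1 3].
move=> D noK noJ; apply: (orthorep_strip (P := P)); last by split.
  move=> A B sAB [DB nB nB']; split; first exact: leq_ltn_trans (degsum_sub sAB) DB.
    exact: contra (has_join_sub sAB) nB.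
  exact: contra (has_join_sub sAB) nB'.
move=> {D noK noJ} {}S [D noK noJ] core.
have [Sle|Sgt] := leqP #|S| e.+2; first exact: orthorep_card_le_add2.
have core_deg x : x \in S -> e.-1 <= deg S x by exact: core.
suff [u [v [uS vS uv nuv [D' noK' noJ']]]] : exists u v,
    [/\ u \in S, v \in S, u != v, ~~ adj u v &
     [/\ degsum (S :\ u :\ v) < (e.-1 + 2) * (e.-1 + 1),
        ~~ has_join (S :\ u :\ v) e 0 & ~~ has_join (S :\ u :\ v) e.-2 3]].
  by apply: (orthorep_add_nonadj nuv); apply: IHd.
(* The number of edges that a surviving forbidden graph requires. *)
have core' u v : {in S :\ u :\ v, forall x, e - 3 <= deg (S :\ u :\ v) x}.
  move=> x /setD1P[_ /setD1P[_ xS]].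
  by move: (leq_deg_rem2 S u v x) (core_deg x xS); clear; lia.
have joinK u v : u \in S -> v \in S -> u != v -> has_join (S :\ u :\ v) e 0 ->
    e * e.-1 + 2 * (e - 3) <= degsum (S :\ u :\ v).
  move=> uS vS uv J; have := has_join_degsum_out J _ (core' u v).
  by rewrite !addn0; apply; move: (card_rem2 uS vS uv) Sgt; clear; lia.
have joinJ u v : has_join (S :\ u :\ v) e.-2 3 ->
    e.-2 * (e + 3) <= degsum (S :\ u :\ v).
  by move/has_join_degsum; congr (_ * _ <= _); rewrite /e; clear; lia.
have [/eqP d0|dpos] := boolP (d == 0); last first.
  have [|u [v [uS vS uv nuv]]] := nonadj_exists noK.
    by move: Sgt; clear; lia.
  exists u, v; split=> //.
  have D' : degsum (S :\ u :\ v) + 4 * e.-1 < (e + 2) * (e + 1).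
    move: (degsum_rem2 uS vS uv nuv) (core_deg u uS) (core_deg v vS) D.
    by move: (degsum _) (degsum _) => a b; clear; lia.
  split.
  - by move: D'; rewrite /e; move: (degsum _) => a; clear; nia.
  - apply/negP => /(joinK u v uS vS uv); move: D' dpos; rewrite /e.
    by move: (degsum _) => a; clear; nia.
  - apply/negP => /(joinJ u v); move: D' dpos; rewrite /e.
    by move: (degsum _) => a; clear; nia.
(* For d = 5, parity turns degree sum at most 41 into at most 40. *)
have e5 : e = 5 by rewrite /e d0.
rewrite e5 /= in D noK noJ Sgt core_deg core' joinK joinJ *.
have D40 : degsum S <= 40.
  rewrite leqNgt; apply/negP => D40; have := degsum_even S.
  by have -> : degsum S = 41 by move: D40 D; clear; lia.
have [S8|Sne8] := eqVneq #|S| 8.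
  have [u [v [uS vS uv nuv D']]] := eight_vertices_pair S8 D core_deg noK.
  have {}D' : degsum (S :\ u :\ v) < 24.
    by move: (degsum_rem2 uS vS uv nuv) D'; clear; lia.
  exists u, v; split=> //; split; first by move: D'; clear; lia.
    by apply/negP => /(joinK u v uS vS uv); move: D'; clear; lia.
  by apply/negP => /(joinJ u v); move: D'; clear; lia.
have [|u [v [uS vS uv nuv]]] := nonadj_exists noK; first by move: Sgt; clear; lia.
have D' : degsum (S :\ u :\ v) <= 24.
  by move: (degsum_rem2 uS vS uv nuv) (core_deg u uS) (core_deg v vS) D40; clear; lia.
have c7 : 6 < #|S :\ u :\ v| by move: (card_rem2 uS vS uv) Sgt Sne8; clear; lia.
exists u, v; split=> //; split; first by move: D'; clear; lia.
  apply/negP => J; have [|w wS J'] := has_join_remove J; first by move: c7; clear; lia.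
  have := @has_join_degsum_out _ _ 5 0 1 J'.
  have cw : 5 + 0 < #|(S :\ u :\ v) :\ w|.
    by move: c7; rewrite (cardsD1 w (_ :\ v)) wS; clear; lia.
  have ge1 : {in (S :\ u :\ v) :\ w, forall x, 1 <= deg ((S :\ u :\ v) :\ w) x}.
    move=> x /setD1P[_ xS]; move: (core' u v x xS) (leq_deg_rem (S :\ u :\ v) x w).
    by clear; lia.
  by move=> /(_ cw ge1); move: (degsum_rem wS) (core' u v w wS) D'; clear; lia.
apply/negP => J; have := @has_join_degsum_out _ _ 3 3 2 J c7 (core' u v).
by move: D'; clear; lia.
Qed.

(** * From representations to unit distances *)

Lemma realizable_of_dot d (X : set 'rV[R]_d) (psi : G -> 'rV[R]_d) :
    injective psi -> (forall x, X ((Num.sqrt 2)^-1 *: psi x)%R) ->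
    (forall x y, adj x y -> dot (psi x - psi y)%R (psi x - psi y)%R = 2%R) ->
  realizable G X.
Proof.
move=> inj inX unit; exists (fun x => (Num.sqrt 2)^-1 *: psi x)%R; split=> //.
  exact: inj_comp (@scale_injective R d) inj.
move=> x y xy; rewrite -scalerBr enorm_scale unit // divff ?sqrtr1 //.
by rewrite pnatr_eq0.
Qed.

(** Orthogonal unit vectors are at distance sqrt 2. *)
Lemma realizable_sphere d : orthorep [set: G] d -> realizable G (sphere R d).
Proof.
move=> [f [inj unit orth]]; apply: (realizable_of_dot (psi := f)).
- by move=> x y; apply: inj; rewrite inE.
- move=> x; rewrite /sphere /= enorm_scale unit ?inE //.
  by rewrite !div1r sqrtrV ?ler0n.
- by move=> x y xy; rewrite dot_sub !unit ?orth ?inE // mulr0 subr0.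
Qed.

(** Let s be the sum of the d orthonormal vectors of the clique.  In the scaling
    where edges have squared length 2, t *: s has the right distance to all of
    them when d t^2 = 2 t + 1.  The two roots t give two points, and their
    squared norms 2 t + 1 differ from each other and from 1, the squared norm
    of all other points. *)
Lemma realizable_apex d K a b : 0 < d ->
    orthorep ([set: G] :\ a :\ b) d -> K \subset [set: G] :\ a :\ b ->
    dominates K K -> #|K| = d ->
    (forall y, adj a y -> y \in K) -> (forall y, adj b y -> y \in K) ->
  realizable G [set: 'rV[R]_d]%classic.
Proof.
move=> d0 [f [inj unit orth]] sK domK cK Na Nb.
have inV x : x != a -> x != b -> x \in [set: G] :\ a :\ b by rewrite !inE => -> ->.
have [_ adjK] := dominatesP _ _ domK.
pose s := (\sum_(k in K) f k)%R.
have sf k : k \in K -> dot s (f k) = 1%R.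
  move=> kK; rewrite dot_suml (bigD1 k) //= unit ?(subsetP sK) // big1 ?addr0 //.
  by move=> j /andP[jK jk]; rewrite orth ?(subsetP sK) ?adjK.
have ss : dot s s = d%:R%R.
  transitivity (#|K|%:R : R)%R; last by rewrite cK.
  rewrite {1}/s dot_suml -sum1_card natr_sum; apply: eq_bigr => k kK.
  by rewrite dotC sf.
(* [t1] and [t2] are the roots of d t^2 = 2 t + 1. *)
pose r : R := Num.sqrt (d.+1%:R).
have dE : (d%:R = r ^+ 2 - 1)%R by rewrite sqr_sqrtr ?ler0n // -natr1 addrK.
have r0 : (r != 0)%R by rewrite sqrtr_eq0 -ltNge ltr0n.
have dn0 : (d%:R != 0 :> R)%R by rewrite pnatr_eq0 -lt0n.
pose t1 : R := ((1 + r) / d%:R)%R; pose t2 : R := ((1 - r) / d%:R)%R.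
have t1E : (t1 ^+ 2 * d%:R = 2 * t1 + 1)%R.
  by rewrite /t1; move: dn0; rewrite dE => h; field.
have t2E : (t2 ^+ 2 * d%:R = 2 * t2 + 1)%R.
  by rewrite /t2; move: dn0; rewrite dE => h; field.
have root0 t : (t ^+ 2 * d%:R = 2 * t + 1 -> 2 * t + 1 != 1 :> R)%R.
  move=> tE; apply/negP => /eqP t0.
  have {}t0 : (t = 0)%R by move: t0; clear; lra.
  by move: tE; rewrite t0 expr0n /= mul0r mulr0 add0r => /eqP; rewrite eq_sym oner_eq0.
have t12 : (2 * t1 + 1 != 2 * t2 + 1)%R.
  apply/negP => /eqP t12; have : (t1 * d%:R = t2 * d%:R)%R by congr (_ * _)%R; move: t12; clear; lra.
  by rewrite /t1 /t2 !mulfVK // => rr; case/negP: r0; apply/eqP; move: rr; clear; lra.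
pose psi x := if x == a then (t1 *: s)%R else if x == b then (t2 *: s)%R else f x.
have norm_apex t : (dot (t *: s) (t *: s) = t ^+ 2 * d%:R)%R.
  by rewrite dotZl dotZr ss mulrA.
have normE x : dot (psi x) (psi x) =
    if x == a then (2 * t1 + 1)%R else if x == b then (2 * t2 + 1)%R else 1%R.
  rewrite /psi; case: eqP => [_|/eqP xa]; first by rewrite norm_apex t1E.
  by case: eqP => [_|/eqP xb]; rewrite ?norm_apex ?t2E // unit // inV.
have apex t y : (t ^+ 2 * d%:R = 2 * t + 1)%R -> y \in K ->
    dot (t *: s - psi y)%R (t *: s - psi y)%R = 2%R.
  move=> tE yK; have := subsetP sK y yK; rewrite !inE => /andP[yb /andP[ya _]].
  rewrite dot_sub norm_apex tE normE /psi (negbTE ya) (negbTE yb) dotZl sf //.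
  by ring.
have subC (p q : 'rV[R]_d) : dot (p - q)%R (p - q)%R = dot (q - p)%R (q - p)%R.
  by rewrite -(opprB q p) dotNl dotNr opprK.
apply: (realizable_of_dot (psi := psi)) => // x y.
  move=> psixy; have := congr1 (fun z => dot z z) psixy; rewrite !normE.
  have n1 := root0 t1 t1E; have n2 := root0 t2 t2E.
  move: psixy; rewrite /psi.
  case: (eqVneq x a) => [->|xa]; case: (eqVneq y a) => [->|ya] //.
  - by case: ifP => _ _ /eqP; rewrite ?(negbTE t12) ?(negbTE n1).
  - by case: ifP => _ _ /esym/eqP; rewrite ?(negbTE t12) ?(negbTE n1).
  - case: (eqVneq x b) => [->|xb]; case: (eqVneq y b) => [->|yb] //.
    + by move=> _ /eqP; rewrite (negbTE n2).
    + by move=> _ /esym/eqP; rewrite (negbTE n2).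
    + by move=> fxy _; apply: inj fxy; apply: inV.
move=> xy.
have [xa|xa] := eqVneq x a.
  by rewrite {1 3}/psi xa eqxx; apply: apex => //; apply: Na; rewrite -xa.
have [ya|ya] := eqVneq y a.
  by rewrite subC {1 3}/psi ya eqxx; apply: apex => //; apply: Na; rewrite -ya adj_sym.
have [xb|xb] := eqVneq x b.
  by rewrite {1 3}/psi (negbTE xa) xb eqxx; apply: apex => //; apply: Nb; rewrite -xb.
have [yb|yb] := eqVneq y b.
  rewrite subC {1 3}/psi (negbTE ya) yb eqxx; apply: apex => //; apply: Nb.
  by rewrite -yb adj_sym.
rewrite dot_sub !normE /psi (negbTE xa) (negbTE xb) (negbTE ya) (negbTE yb).
by rewrite orth ?inV // mulr0 subr0.
Qed.

End Orthorep.

(** * Graphs that contain a forbidden subgraph *)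

Section Space.
Variables (R : realType) (G : sgraph) (d : nat).
Hypothesis d_gt3 : 3 < d.
Hypothesis few_edges : degsum [set: G] + 2 <= (d + 2) * (d + 1).
Local Notation V := [set: G].

(** At most d edges lie outside the clique [A], so one of its d + 1 vertices,
    [a], has no neighbour outside [A] and can be an apex.  If there is another
    (d+1)-clique without [a], the edge count forces it to be [A :\ a] with
    one more vertex [b], and [a], [b] are the two apices. *)
Lemma realizable_of_clique : has_join V d.+1 0 ->
  realizable G [set: 'rV[R]_d]%classic.
Proof.
move=> /has_clique[A [domA _ cA]]; have [_ adjA] := dominatesP _ _ domA.
have DA (B : {set G}) : dominates B B -> #|B| = d.+1 -> d.+1 * d <= degsum B.
  by move=> /degsum_dominates + cB; rewrite cB subnn addn0.
have [a aA outa] : exists2 a, a \in A & deg (V :\: A) a = 0.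
  have [/exists_inP[a aA /eqP]|/exists_inPn no0] := boolP [exists a in A, deg (V :\: A) a == 0].
    by exists a.
  have : \sum_(a in A) 1 <= \sum_(a in A) deg (V :\: A) a.
    by apply: leq_sum => a /no0; rewrite lt0n.
  rewrite sum1_card cA; move: (degsum_outward (subsetT A)) (DA _ domA cA) few_edges.
  by move: (\sum_(_ in _) _) (degsum A) (degsum V) => p q r; clear; nia.
pose K := A :\ a.
have cK : #|K| = d by move: cA; rewrite (cardsD1 a) aA; case.
have domK : dominates K K.
  by apply/dominatesP; split=> // x y /setD1P[_ xA] /setD1P[_ yA]; exact: adjA.
have Na y : adj a y -> y \in K.
  move=> ay; rewrite !inE; apply/andP; split.
    by apply: contraTneq ay => ->; rewrite adj_irrefl.
  apply: contraT => yA; have : y \in [set z in V :\: A | adj a z] by rewrite !inE yA.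
  by rewrite (cards0_eq outa) inE.
have sKV : K \subset V :\ a by apply/subsetP => x; rewrite !inE => /andP[->].
have dega : d <= deg V a.
  by have := deg_sub a (subsetT A); rewrite (deg_dominates domA aA) cA.
have D1 : degsum (V :\ a) <= d.+1 * d.
  by move: (degsum_rem (in_setT a)) dega few_edges; move: (degsum _) (degsum _) => p q; clear; nia.
have noJ : ~~ has_join (V :\ a) d.-1 3.
  apply/negP => /has_join_degsum; move: D1 d_gt3.
  by move: (degsum _) => p; clear; nia.
have [J|noK] := boolP (has_join (V :\ a) d.+1 0); last first.
  apply: (@realizable_apex _ _ _ K a a) => //; first exact: leq_trans _ d_gt3.
    apply: orthorep_sub (subsetDl _ _) _; apply: orthorep_few_edges => //.
    by move: D1; move: (degsum _) => p; clear; nia.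
  by apply/subsetP => x; rewrite !inE => /andP[->].
have {J} [B [domB sBV cB]] := has_clique J.
have DB := DA _ domB cB.
(* [B] already accounts for all the edges that do not meet [a]. *)
have tight y : y \in V :\ a -> y \notin B -> deg (V :\ a) y = 0.
  move=> yV yB; move: (degsum_out sBV yV yB) D1 DB.
  by move: (degsum _) (degsum _) (deg _ _) => p q r; clear; lia.
have sKB : K \subset B.
  apply/subsetP => y yK; apply: contraT => yB.
  have := deg_sub y sKV; rewrite (deg_dominates domK yK) cK.
  by rewrite tight ?(subsetP sKV) //; move: d_gt3; clear; lia.
have /subsetPn[b bB bK] : ~~ (B \subset K).
  by apply/negP => /subset_leq_card; rewrite cB cK ltnn.
have BE : B = b |: K.
  by apply/esym/eqP; rewrite eqEcard subUset sub1set bB sKB cardsU1 bK cK cB add1n /=.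
have bV := subsetP sBV b bB.
have Nb y : adj b y -> y \in K.
  move=> bY; have ya : y \in V :\ a.
    rewrite !inE andbT; apply: contraNneq bK => ya; apply: Na.
    by rewrite adj_sym -ya.
  have : y \in B.
    apply: contraT => /(tight y ya)/eqP; rewrite -leqn0 leqNgt => /negP[].
    by apply/card_gt0P; exists b; rewrite inE bV adj_sym.
  rewrite BE !in_setU1 => /predU1P[yb|//].
  by move: bY; rewrite yb adj_irrefl.
have D2 : degsum (V :\ a :\ b) < d.+1 * d.
  have := deg_sub b sBV; rewrite (deg_dominates domB bB) cB /=.
  move: (degsum_rem bV) D1 d_gt3; move: (degsum _) (degsum _) (deg _ _) => p q r.
  by clear; lia.
apply: (@realizable_apex _ _ _ K a b) => //; first exact: leq_trans _ d_gt3.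
  apply: orthorep_few_edges => //.
  - by move: D2; move: (degsum _) => p; clear; nia.
  - apply/negP => /has_join_degsum; move: D2; rewrite !addn0 /=.
    by move: (degsum _) => p; clear; lia.
  - by apply: contra noJ; apply: has_join_sub; exact: subsetDl.
by rewrite subsetD1 sKV bK.
Qed.

(** At most two edges lie outside the join, so one of its three pairwise
    nonadjacent vertices has only the (d-1)-clique as neighbours.  Together
    with another of the three that clique has d vertices. *)
Lemma realizable_of_join3 : ~~ has_join V d.+1 0 -> has_join V d.-1 3 ->
  realizable G [set: 'rV[R]_d]%classic.
Proof.
move=> noK /has_joinP[C [Y [domC _ cC cY]]]; have [sCY adjC] := dominatesP _ _ domC.
have domCC : dominates C C.
  by apply/dominatesP; split=> // x y xC /(subsetP sCY); exact: adjC.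
pose I := Y :\: C.
have cI : #|I| = 3 by rewrite cardsD (setIidPr sCY) cY cC addKn.
have addI x : x \in I -> dominates (x |: C) (x |: C).
  move=> /setDP[xY xC]; apply: clique_add => // y yC.
  by rewrite adj_sym adjC //; apply: contraNneq xC => <-.
have indep x y : x \in I -> y \in I -> ~~ adj x y.
  move=> xI yI; apply: contra noK => xy; apply: (has_join_sub (subsetT (y |: (x |: C)))).
  have [yY yC] := setDP yI; have [xY xC] := setDP xI.
  have nyx : y != x by apply: contraTneq xy => ->; rewrite adj_irrefl.
  apply: clique_has_join; last first.
    by rewrite !cardsU1 in_setU1 negb_or nyx yC xC cC; move: d_gt3; clear; lia.
  apply: clique_add; first exact: addI.
  move=> z /setU1P[->|zC]; rewrite adj_sym // adjC //.
  by apply: contraNneq yC => <-.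
have DY : d.-1 * (d + 4) <= degsum Y.
  have := degsum_dominates domC; rewrite cC cY addKn.
  by move: d_gt3 (degsum Y); case: (d) => // e _ q; clear; nia.
have [x xI outx] : exists2 x, x \in I & deg (V :\: Y) x = 0.
  have [/exists_inP[a aA /eqP]|/exists_inPn no0] := boolP [exists a in I, deg (V :\: Y) a == 0].
    by exists a.
  have : \sum_(a in I) 1 <= \sum_(a in I) deg (V :\: Y) a.
    by apply: leq_sum => a /no0; rewrite lt0n.
  rewrite sum1_card cI => I3.
  have : 3 <= \sum_(a in Y) deg (V :\: Y) a.
    by rewrite (big_setID C) /=; exact: leq_trans I3 (leq_addl _ _).
  move: (degsum_outward (subsetT Y)) DY few_edges d_gt3.
  by move: (\sum_(_ in _) _) (degsum Y) (degsum V) => p q r; clear; nia.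
have [xY xC] := setDP xI.
have Nx y : adj x y -> y \in C.
  move=> xy; apply: contraT => yC; have [yY|yY] := boolP (y \in Y).
    by have := indep x y xI; rewrite inE yC yY xy => /(_ isT).
  have : y \in [set z in V :\: Y | adj x z] by rewrite !inE yY.
  by rewrite (cards0_eq outx) inE.
have /subsetPn[y yI yx] : ~~ (I \subset [set x]).
  by apply/negP => /subset_leq_card; rewrite cards1 cI.
have [yY yC] := setDP yI.
have degx : d.-1 <= deg V x.
  by rewrite -cC; apply: leq_trans (deg_dominated domC xY xC) (deg_sub _ (subsetT _)).
apply: (@realizable_apex _ _ _ (y |: C) x x) => //.
- exact: leq_trans _ d_gt3.
- apply: orthorep_sub (subsetDl _ _) _.
  have D1 : degsum (V :\ x) + 2 * d.-1 + 2 <= (d + 2) * (d + 1).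
    by move: (degsum_rem (in_setT x)) degx few_edges; move: (degsum _) (degsum _) (deg _ _) => p q r; clear; lia.
  apply: orthorep_few_edges => //.
  + by move: D1; move: (degsum _) => p; clear; lia.
  + by apply: contra noK; apply: has_join_sub; exact: subsetT.
  + apply/negP => /has_join_degsum; move: D1 d_gt3.
    by move: (degsum _) => p; clear; nia.
- apply/subsetP => z zK; rewrite !inE andbT andbb; apply: contraTneq zK => ->.
  by rewrite in_setU1 negb_or eq_sym xC andbT; move: yx; rewrite inE.
- exact: addI.
- by rewrite cardsU1 yC cC; move: d_gt3; clear; lia.
- by move=> z /Nx; rewrite in_setU1 orbC => ->.
- by move=> z /Nx; rewrite in_setU1 orbC => ->.
Qed.

End Space.

Theorem theorem3 (R : realType) (d : nat) (hd : 3 < d) (G : sgraph)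
    (hG : #|edges G| < 'C(d + 2, 2)) :
  realizable G [set: 'rV[R]_d]%classic /\
  (~ contains G (complete_minus (d + 2) 3) ->
   ~ contains G (complete (d + 1)) ->
   realizable G (sphere R d)).
Proof.
have D : degsum [set: G] + 2 <= (d + 2) * (d + 1).
  have binE : 'C(d + 2, 2) * 2 = (d + 2) * (d + 1).
    by rewrite (bin_ffact (d + 2) 2) ffactnS ffactn1 [in RHS]addn1 {2}addn2.
  by rewrite -binE degsum_setT; move: hG; move: #|_| 'C(_, _) => e c; clear; lia.
have sphere_of : ~~ has_join [set: G] d.+1 0 -> ~~ has_join [set: G] d.-1 3 ->
    orthorep R [set: G] d.
  by apply: orthorep_few_edges => //; move: D; clear; lia.
split.
  have [J|noK] := boolP (has_join [set: G] d.+1 0); first exact: realizable_of_clique J.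
  have [J|noJ] := boolP (has_join [set: G] d.-1 3); first exact: realizable_of_join3 J.
  by have [f [inj unit orth]] := realizable_sphere (sphere_of noK noJ); exists f; split.
move=> noJ noK; apply/realizable_sphere/sphere_of; apply/negP.
  by move/contains_complete; rewrite -addn1.
move/contains_complete_minus; have -> : d.-1 + 3 = d + 2 by move: hd; clear; lia.
exact: noJ.
Qed.
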